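(* Let $X$ be a Banach lattice. If every unconditional basic sequence in $X$ is absolute, then $X$ is lattice isomorphic to an AM-space, i.e. to a closed sublattice of a $C(K)$-space.
   Context: A sequence $(x_k)$ of nonzero vectors in a Banach lattice is absolute if there is $A\ge1$ with $\|\sum_{k=1}^m|a_kx_k|\|\le A\|\sum_{k=1}^ma_kx_k\|$ for all $m$ and all scalars $a_1,\dots,a_m$. *)

(* Defs.v *)
From HB Require Import structures.
From mathcomp Require Import all_boot all_order all_algebra.
From mathcomp Require Import all_classical all_reals all_analysis.
Set Implicit Arguments. Unset Strict Implicit. Unset Printing Implicit Defensive.
Import Order.TTheory GRing.Theory Num.Theory.
Import numFieldNormedType.Exports.
Local Open Scope classical_set_scope.
Local Open Scope ring_scope.

Section BanachLattice.
Variables (R : realType) (X : completeNormedModType R).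
Variables (le : X -> X -> Prop) (join : X -> X -> X).

Definition labs (x : X) : X := join x (- x).

Definition is_banach_lattice : Prop :=
  (forall x, le x x) /\
  (forall x y, le x y -> le y x -> x = y) /\
  (forall x y z, le x y -> le y z -> le x z) /\
  (forall x y z, le x y -> le (x + z) (y + z)) /\
  (forall (a : R) x y, 0 <= a -> le x y -> le (a *: x) (a *: y)) /\
  (forall x y, le x (join x y) /\ le y (join x y)) /\
  (forall x y z, le x z -> le y z -> le (join x y) z) /\
  (forall x y, le (labs x) (labs y) -> `|x| <= `|y|).

Definition closed_span (x : nat -> X) : set X :=
  closure [set y | exists (n : nat) (a : nat -> R), y = \sum_(k < n) a k *: x k].

Definition expands (x : nat -> X) (a : nat -> R) (y : X) : Prop :=
  (fun n => \sum_(k < n) a k *: x k) @ \oo --> y.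

Definition basic_seq (x : nat -> X) : Prop :=
  (forall k, x k != 0) /\
  forall y, closed_span x y ->
    exists a, expands x a y /\ forall b, expands x b y -> b = a.

Definition unconditional_basic_seq (x : nat -> X) : Prop :=
  basic_seq x /\
  forall y a, closed_span x y -> expands x a y ->
    forall s : nat -> nat, bijective s ->
      (fun n => \sum_(k < n) a (s k) *: x (s k)) @ \oo --> y.

Definition absolute_seq (x : nat -> X) : Prop :=
  (forall k, x k != 0) /\
  exists A : R, 1 <= A /\
    forall (m : nat) (a : nat -> R),
      `| \sum_(k < m) labs (a k *: x k) | <= A * `| \sum_(k < m) a k *: x k |.

End BanachLattice.

(* X is lattice isomorphic to a closed sublattice of C(K), K compact
   Hausdorff: T : X -> C(K) linear, lattice homomorphism (hence its range is
   a sublattice), and an isomorphism onto its range for the sup norm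
   (hence injective with closed range, X being complete). *)
Definition lattice_iso_to_AM_space (R : realType) (X : completeNormedModType R)
  (join : X -> X -> X) : Prop :=
  exists (K : topologicalType) (T : X -> K -> R),
    hausdorff_space K /\ compact [set: K] /\
    (forall x, continuous (T x)) /\
    (forall (a : R) x y t, T (a *: x + y) t = a * T x t + T y t) /\
    (forall x y t, T (join x y) t = Num.max (T x t) (T y t)) /\
    (exists c C : R, 0 < c /\ 0 < C /\
       forall x, (forall t, `|T x t| <= C * `|x|) /\
                 c * `|x| <= sup [set `|T x t| | t in [set: K]]).

(* Main.v *)
(* If [X] is not an M-space up to renorming, suprema of positive vectors of the
   unit ball have unbounded norm, and we exhibit an unconditional basic sequence
   that is not absolute.

   Fix a normalized disjoint sequence [w] (if there is none, [X] is spanned by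
   finitely many atoms and the suprema are bounded).  Non-absolute sequences
   arise as perturbations [z = w + T w], where [T] has small norm on the span of
   [w] but large modulus; [z] is then equivalent to [w], hence unconditional.
   - If [sup {sum |c_k|^q : |sum c_k w_k| <= 1} = oo] on every tail of [w] for
     some [q > 1], take a nearly extremal [a] and let [T] send [w_k] to
     [a_k^(q-1) sum_i r_i(k) g_i], where the [r_i] are signs, almost orthonormal
     for the weights [a_k^q], and the [g_i] are nearly disjoint pieces of
     vectors [f_i] of the unit ball with large supremum.
   - Otherwise the span of [w] contains l1^n's on blocks.  If no tail of [w] is
     equivalent to the basis of l1, let [T] map [w_k] to Rademacher sums
     supported on these blocks.
   - If a tail of [w] is equivalent to the basis of l1, Rademacher sums on
     consecutive blocks of it form the required sequence directly.

   If the suprema are bounded by [C], the gauge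
   [inf {r : y <= sup f_i, |f_i| <= r}] is an equivalent M-seminorm.  A minimal
   sublinear functional [p] with [p (x \/ y) = max (p x) (p y)] is linear, so
   Zorn's lemma yields enough lattice homomorphisms to embed [X] into [C(K)].
   The same lemma, applied to the order-unit gauge of a principal ideal, reduces
   lattice inequalities in [X] to inequalities between real numbers. *)
Require Import Defs.
From HB Require Import structures.
From mathcomp Require Import all_boot all_order all_algebra.
From mathcomp Require Import all_classical all_reals all_analysis.
From mathcomp Require Import ring lra zify.
Set Implicit Arguments. Unset Strict Implicit. Unset Printing Implicit Defensive.
Import Order.TTheory GRing.Theory Num.Theory.
Import numFieldNormedType.Exports.
Local Open Scope classical_set_scope.
Local Open Scope ring_scope.

(** * Vector lattice calculus and lattice homomorphisms *)

Section Lattice.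
Variables (R : realType) (X : completeNormedModType R).
Variables (le : X -> X -> Prop) (join : X -> X -> X).
Hypothesis H : is_banach_lattice le join.
Local Notation labs := (labs join).
Implicit Types (x y z e u : X) (a b r s : R).

Lemma blle_refl x : le x x. Proof. by case: H => h _; exact: h. Qed.
Lemma blle_anti x y : le x y -> le y x -> x = y.
Proof. by case: H => _ [h _]; exact: h. Qed.
Lemma blle_trans y x z : le x y -> le y z -> le x z.
Proof. by case: H => _ [_ [h _]]; exact: h. Qed.
Lemma blle_addr z x y : le x y -> le (x + z) (y + z).
Proof. by case: H => _ [_ [_ [h _]]]; exact: h. Qed.
Lemma blle_scale a x y : 0 <= a -> le x y -> le (a *: x) (a *: y).
Proof. by case: H => _ [_ [_ [_ [h _]]]]; exact: h. Qed.
Lemma bljoinl x y : le x (join x y).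
Proof. by case: H => _ [_ [_ [_ [_ [h _]]]]]; case: (h x y). Qed.
Lemma bljoinr x y : le y (join x y).
Proof. by case: H => _ [_ [_ [_ [_ [h _]]]]]; case: (h x y). Qed.
Lemma bljoin_lub x y z : le x z -> le y z -> le (join x y) z.
Proof. by case: H => _ [_ [_ [_ [_ [_ [h _]]]]]]; exact: h. Qed.
Lemma norm_labs_le x y : le (labs x) (labs y) -> `|x| <= `|y|.
Proof. by case: H => _ [_ [_ [_ [_ [_ [_ h]]]]]]; exact: h. Qed.
Hint Resolve blle_refl bljoinl bljoinr : core.

Lemma blle_add x y z t : le x y -> le z t -> le (x + z) (y + t).
Proof.
move=> xy zt; apply: (@blle_trans (y + z)); first exact: blle_addr.
by rewrite ![y + _]addrC; exact: blle_addr.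
Qed.

Lemma blsubr_ge0 x y : le 0 (y - x) <-> le x y.
Proof.
split=> h; first by have := blle_addr x h; rewrite add0r subrK.
by have := blle_addr (- x) h; rewrite subrr.
Qed.

Lemma blle_opp x y : le x y -> le (- y) (- x).
Proof. by move=> /blsubr_ge0 h; apply/blsubr_ge0; rewrite opprK addrC. Qed.

Lemma scale_blge0 a x : 0 <= a -> le 0 x -> le 0 (a *: x).
Proof. by move=> a0 x0; have := blle_scale a0 x0; rewrite scaler0. Qed.

Lemma scale_blle a b x : le 0 x -> a <= b -> le (a *: x) (b *: x).
Proof.
move=> x0 ab; apply/blsubr_ge0; rewrite -scalerBl.
by apply: scale_blge0 => //; rewrite subr_ge0.
Qed.

Lemma sum_blge0 (I : Type) (s : seq I) (P : pred I) (F : I -> X) :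
  (forall i, P i -> le 0 (F i)) -> le 0 (\sum_(i <- s | P i) F i).
Proof.
move=> h; apply: big_rec => // i x Pi x0; rewrite -[0]addr0; apply: blle_add => //.
exact: h.
Qed.

Lemma sum_blle (I : Type) (s : seq I) (P : pred I) (F G : I -> X) :
  (forall i, P i -> le (F i) (G i)) ->
  le (\sum_(i <- s | P i) F i) (\sum_(i <- s | P i) G i).
Proof.
by move=> h; apply: (big_ind2 le) => // *; exact: blle_add.
Qed.

Lemma sum_blle_term (I : finType) (P : pred I) (F : I -> X) j : P j ->
  (forall i, P i -> le 0 (F i)) -> le (F j) (\sum_(i | P i) F i).
Proof.
move=> Pj h; rewrite (bigD1 j) //= -[F j in X in le X _]addr0; apply: blle_add => //.
by apply: sum_blge0 => i /andP[+ _]; exact: h.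
Qed.

Lemma bljoinC x y : join x y = join y x.
Proof. by apply: blle_anti; apply: bljoin_lub. Qed.

Lemma bljoin_idr x y : le x y -> join x y = y.
Proof. by move=> xy; apply: blle_anti => //; apply: bljoin_lub. Qed.

Lemma bljoin_idl x y : le y x -> join x y = x.
Proof. by move=> xy; rewrite bljoinC bljoin_idr. Qed.

Lemma bljoin_addr x y z : join x y + z = join (x + z) (y + z).
Proof.
apply: blle_anti; last by apply: bljoin_lub; exact: blle_addr.
suff : le (join x y) (join (x + z) (y + z) - z).
  by move=> /(blle_addr z); rewrite subrK.
by apply: bljoin_lub; apply/blsubr_ge0; rewrite addrAC -addrA -opprD addrC;
   rewrite ?[z + _]addrC [X in le _ X]addrC; apply/blsubr_ge0.
Qed.

Lemma bljoin_scale a x y : 0 <= a -> a *: join x y = join (a *: x) (a *: y).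
Proof.
rewrite le_eqVlt => /predU1P[<-|a0].
  by rewrite !scale0r bljoin_idr.
apply: blle_anti; last by apply: bljoin_lub; apply: blle_scale; rewrite ?ltW.
have a1 : 0 <= a^-1 by rewrite invr_ge0 ltW.
rewrite -[X in le _ X]scale1r -(divff (lt0r_neq0 a0)) -scalerA.
apply: blle_scale (ltW a0) _; apply: bljoin_lub.
  rewrite -[X in le X _]scale1r -(mulVf (lt0r_neq0 a0)) -scalerA.
  exact: blle_scale.
rewrite -[X in le X _]scale1r -(mulVf (lt0r_neq0 a0)) -scalerA.
exact: blle_scale.
Qed.

Lemma labs_ge x : le x (labs x). Proof. exact: bljoinl. Qed.
Lemma labs_geN x : le (- x) (labs x). Proof. exact: bljoinr. Qed.
Lemma labs_lub x y : le x y -> le (- x) y -> le (labs x) y.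
Proof. exact: bljoin_lub. Qed.

Lemma labs_ge0 x : le 0 (labs x).
Proof.
have h : le 0 (2 *: labs x).
  rewrite -(subrr x) scaler_nat mulr2n; apply: blle_add; [exact: labs_ge|exact: labs_geN].
have := @scale_blge0 2^-1 _ _ h; rewrite scalerA mulVf ?pnatr_eq0 // scale1r.
by apply; rewrite invr_ge0.
Qed.

Lemma ge0_labs x : le 0 x -> labs x = x.
Proof.
move=> x0; apply: blle_anti; last exact: labs_ge.
apply: labs_lub => //; apply: (@blle_trans 0) => //.
by rewrite -[0]oppr0; exact: blle_opp.
Qed.

Lemma labs_opp x : labs (- x) = labs x.
Proof. by rewrite /labs opprK bljoinC. Qed.

Lemma labs_scale a x : labs (a *: x) = `|a| *: labs x.
Proof.
have [a0|a0] := leP 0 a.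
  by rewrite ger0_norm // /labs bljoin_scale // scalerN.
rewrite ltr0_norm // /labs bljoin_scale ?oppr_ge0 ?ltW//.
by rewrite scalerN !scaleNr opprK bljoinC.
Qed.

Lemma labs_add x y : le (labs (x + y)) (labs x + labs y).
Proof.
apply: labs_lub; first by apply: blle_add; exact: labs_ge.
by rewrite opprD; apply: blle_add; exact: labs_geN.
Qed.

Lemma labs_sum (I : Type) (s : seq I) (P : pred I) (F : I -> X) :
  le (labs (\sum_(i <- s | P i) F i)) (\sum_(i <- s | P i) labs (F i)).
Proof.
apply: (big_ind2 (fun x y => le (labs x) y)) => //.
  by rewrite ge0_labs.
move=> x x' y y' h h'; apply: blle_trans (labs_add _ _) _; exact: blle_add.
Qed.

Lemma norm_labs x : `|labs x| = `|x|.
Proof.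
by apply/eqP; rewrite eq_le !norm_labs_le // (@ge0_labs (labs x)) //; exact: labs_ge0.
Qed.

Lemma norm_blle x y : le (labs x) y -> `|x| <= `|y|.
Proof.
move=> h; apply: norm_labs_le; rewrite (@ge0_labs y) //.
exact: blle_trans (labs_ge0 x) h.
Qed.

Lemma norm_blge0 x y : le 0 x -> le x y -> `|x| <= `|y|.
Proof. by move=> x0 xy; apply: norm_blle; rewrite ge0_labs. Qed.

(** * Lattice homomorphisms below join-preserving sublinear functionals *)

Section Hom.
Variable D : set X.

(** Homomorphisms are taken relative to a set [D], because the extension argument is applied both to
    the whole space and to principal ideals. *)
Definition sublattice :=
  [/\ forall x y, D x -> D y -> D (x + y), forall a x, D x -> D (a *: x)
    & forall x y, D x -> D y -> D (join x y)].

Definition lathom (phi : X -> R) :=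
  [/\ forall x y, D x -> D y -> phi (x + y) = phi x + phi y,
      forall a x, D x -> phi (a *: x) = a * phi x
    & forall x y, D x -> D y -> phi (join x y) = Num.max (phi x) (phi y)].

(** Only an inequality for positive scalars is asked; applying it to the inverse scalar upgrades it
    to an equality. *)
Definition maxsublinear (p : X -> R) :=
  [/\ forall x y, D x -> D y -> p (x + y) <= p x + p y,
      forall a x, 0 < a -> D x -> p (a *: x) <= a * p x
    & forall x y, D x -> D y -> p (join x y) = Num.max (p x) (p y)].

Hypothesis DS : sublattice.
Hypothesis D0 : D 0.

Let DA x y : D x -> D y -> D (x + y). Proof. by case: DS => h _ _; exact: h. Qed.
Let DZ a x : D x -> D (a *: x). Proof. by case: DS => _ h _; exact: h. Qed.
Let DJ x y : D x -> D y -> D (join x y). Proof. by case: DS => _ _; apply. Qed.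
Let DN x : D x -> D (- x). Proof. by rewrite -scaleN1r; exact: DZ. Qed.

Lemma maxsublinear_scale p a x : maxsublinear p -> 0 < a -> D x ->
  p (a *: x) = a * p x.
Proof.
move=> [_ pZ _] a0 Dx; apply/eqP; rewrite eq_le pZ //=.
have ai : 0 < a^-1 by rewrite invr_gt0.
have := pZ _ _ ai (DZ a Dx); rewrite scalerA mulVf ?gt_eqF// scale1r.
by rewrite mulrC ler_pdivlMr // mulrC.
Qed.

Lemma maxsublinear0 p : maxsublinear p -> p 0 = 0.
Proof.
move=> pm; have := @maxsublinear_scale p 2 0 pm (ltr0Sn _ _) D0.
by rewrite scaler0; lra.
Qed.

Lemma maxsublinear_opp p x : maxsublinear p -> D x -> - p (- x) <= p x.
Proof.
move=> pm Dx; have := pm => -[pA _ _].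
have := pA _ _ Dx (DN Dx); rewrite subrr maxsublinear0 //; lra.
Qed.

Let le_max_l v v' : v <= Num.max v v' :> R. Proof. by rewrite le_max lexx. Qed.
Let le_max_r v v' : v' <= Num.max v v' :> R. Proof. by rewrite le_max lexx orbT. Qed.

Lemma inf_lb_le (S : set R) c (z : R) : (forall v, S v -> c <= v) -> S z -> inf S <= z.
Proof. by move=> h Sz; apply: ge_inf => //; exists c => v /h. Qed.

(* The Hahn-Banach step; it stays in the class because the infimum over [s] is
   a decreasing limit, so two approximants can use a common [s]. *)
Lemma maxsublinear_step p u : maxsublinear p -> D u ->
  exists q, [/\ maxsublinear q, forall y, D y -> q y <= p y
    & forall y s, 0 <= s -> D y -> q y <= p (y + s *: u) - s * p u].
Proof.
move=> pm Du; have [pA pZ pJ] := pm.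
(* The new functional is the infimum of [S y]. The value at [s = 0] puts it below [p], and
   subadditivity gives the lower bound [- p (- y)]. *)
pose S y := [set p (y + s *: u) - s * p u | s in [set s | 0 <= s]].
have Slb y v : D y -> S y v -> - p (- y) <= v.
  move=> Dy [s /= s0 <-].
  have := pA _ _ (DA Dy (DZ s Du)) (DN Dy); rewrite addrAC subrr add0r.
  suff -> : p (s *: u) = s * p u by lra.
  move: s0; rewrite le_eqVlt => /predU1P[<-|s0].
    by rewrite scale0r mul0r maxsublinear0.
  by rewrite maxsublinear_scale.
have S_n y : S y !=set0 by exists (p (y + 0 *: u) - 0 * p u); exists 0 => /=.
have qle y s : 0 <= s -> D y -> inf (S y) <= p (y + s *: u) - s * p u.
  by move=> s0 Dy; apply: (@inf_lb_le _ (- p (- y))); [move=> v; exact: Slb|exists s].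
(* Splitting off [(t - s) *: u] by subadditivity shows that the expression decreases in [s]. *)
have mono y s t : D y -> 0 <= s -> s <= t ->
    p (y + t *: u) - t * p u <= p (y + s *: u) - s * p u.
  move=> Dy s0; rewrite le_eqVlt => /predU1P[->//|st].
  have := pA _ _ (DA Dy (DZ s Du)) (DZ (t - s) Du).
  rewrite -addrA -scalerDl (addrC s) subrK maxsublinear_scale ?subr_gt0 //; lra.
have approx y v : D y -> inf (S y) < v ->
    exists2 s, 0 <= s & p (y + s *: u) - s * p u < v.
  by move=> Dy /inf_lt -/(_ (S_n y))[_ [s s0 <-] h]; exists s.
exists (fun y => inf (S y)); split=> [|y Dy|y s s0 Dy]; last exact: qle.
- split=> [x y Dx Dy|a x a0 Dx|x y Dx Dy].
  + apply/ler_addgt0Pr => eps eps0.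
    have e20 : 0 < eps / 2 by lra.
    have [s s0 hs] := @approx x (inf (S x) + eps / 2) Dx ltac:(lra).
    have [t t0 ht] := @approx y (inf (S y) + eps / 2) Dy ltac:(lra).
    have := @qle (x + y) (s + t) ltac:(lra) (DA Dx Dy).
    have := pA _ _ (DA Dx (DZ s Du)) (DA Dy (DZ t Du)).
    rewrite addrACA -scalerDl; lra.
  + rewrite -ler_pdivrMl //; apply: lb_le_inf => // _ [s /= s0 <-].
    rewrite ler_pdivrMl //.
    have := @qle (a *: x) (a * s) (mulr_ge0 (ltW a0) s0) (DZ _ Dx).
    rewrite -scalerA -scalerDr maxsublinear_scale //; last exact: DA (DZ _ _).
    by rewrite mulrBr mulrA.
  + apply/eqP; rewrite eq_le; apply/andP; split; last first.
      rewrite ge_max; apply/andP; split; apply: lb_le_inf => // _ [s /= s0 <-].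
        have := qle x s s0 Dx; rewrite bljoin_addr pJ; [|exact: DA (DZ _ _)..].
        by move=> /le_trans; apply; rewrite lerD2r le_max lexx.
      have := qle y s s0 Dy; rewrite bljoin_addr pJ; [|exact: DA (DZ _ _)..].
      by move=> /le_trans; apply; rewrite lerD2r le_max lexx orbT.
    rewrite leNgt; apply/negP => hlt.
    have [s s0 hs] := @approx x _ Dx (le_lt_trans (le_max_l _ _) hlt).
    have [t t0 ht] := @approx y _ Dy (le_lt_trans (le_max_r _ _) hlt).
    pose m := Num.max s t.
    have m0 : 0 <= m by rewrite le_max s0.
    have hx := mono x s m Dx s0 ltac:(by rewrite le_max lexx).
    have hy := mono y t m Dy t0 ltac:(by rewrite le_max lexx orbT).
    have := qle (join x y) m m0 (DJ Dx Dy).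
    rewrite bljoin_addr pJ; [|exact: DA (DZ _ _)..].
    by rewrite maxElt; case: ifP => _; lra.
- have := qle y 0 (lexx 0) Dy; by rewrite scale0r addr0 mul0r subr0.
Qed.

(** Zorn's lemma gives a minimal functional [q] of the class. The Hahn-Banach step in a direction
    [u] cannot lower it, so [q y <= q (y + u) - q u]; with subadditivity this is additivity. *)
Lemma lathom_exists p x0 : maxsublinear p -> D x0 ->
  exists phi, [/\ lathom phi, forall y, D y -> phi y <= p y & phi x0 = p x0].
Proof.
(* A first step in the direction [x0] makes [p1 (- x0) <= - p x0]. Everything below [p1] inherits
   this, so the final linear functional takes the value [p x0] at [x0]. *)
move=> pm Dx0; have [p1 [p1m p1p p1x]] := maxsublinear_step pm Dx0.
pose T := {q : X -> R | maxsublinear q /\ forall y, D y -> q y <= p1 y}.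
pose mk q (qm : maxsublinear q) (qp : forall y, D y -> q y <= p1 y) : T :=
  exist (fun q => maxsublinear q /\ forall y, D y -> q y <= p1 y) q (conj qm qp).
pose t0 : T := mk p1 p1m (fun y _ => lexx (p1 y)).
(* The order is reversed, since the form of Zorn's lemma used produces maximal elements. *)
pose Rl (q r : T) := `[< forall y, D y -> sval r y <= sval q y >].
have [||A totA|q qmax] := @ZL_preorder T t0 Rl.
- by move=> t; apply/asboolP.
- move=> r s t /asboolP rs /asboolP st; apply/asboolP => y Dy.
  exact: le_trans (st y Dy) (rs y Dy).
- have [A0|/set0P[a0 Aa0]] := eqVneq A set0.
    by exists t0 => s; rewrite A0.
  pose S y := [set sval q y | q in A].
  have Slb y v : D y -> S y v -> - p1 (- y) <= v.
    move=> Dy [[q [qm qp1]] Aq <-] /=.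
    apply: le_trans (maxsublinear_opp qm Dy); rewrite lerN2; exact/qp1/DN.
  have S_n y : S y !=set0 by exists (sval a0 y); exists a0.
  have qle q y : A q -> D y -> inf (S y) <= sval q y.
    by move=> Aq Dy; apply: (@inf_lb_le _ (- p1 (- y))); [move=> v; exact: Slb|exists q].
  have approx y v : D y -> inf (S y) < v -> exists2 q, A q & sval q y < v.
    by move=> Dy /inf_lt -/(_ (S_n y))[_ [q Aq <-] h]; exists q.
  (* In a chain the smaller of two members approximates both infima at once; hence the infimum of a
     chain stays in the class. *)
  have common x y v v' : D x -> D y -> inf (S x) < v -> inf (S y) < v' ->
      exists q, [/\ A q, sval q x < v & sval q y < v'].
    move=> Dx Dy /(approx _ _ Dx)[q Aq qx] /(approx _ _ Dy)[q' Aq' qy].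
    have [/asboolP h|/asboolP h] := totA q q' Aq Aq'.
      by exists q'; split=> //; exact: le_lt_trans (h _ Dx) qx.
    by exists q; split=> //; exact: le_lt_trans (h _ Dy) qy.
  have infm : maxsublinear (fun y => inf (S y)).
    split=> [x y Dx Dy|a x a0' Dx|x y Dx Dy].
    + apply/ler_addgt0Pr => eps eps0.
      have [q [Aq qx qy]] := @common x y (inf (S x) + eps / 2) (inf (S y) + eps / 2)
        Dx Dy ltac:(lra) ltac:(lra).
      have := qle _ _ Aq (DA Dx Dy).
      have [[qA _ _] _] := svalP q; have := qA _ _ Dx Dy; lra.
    + rewrite -ler_pdivrMl //; apply: lb_le_inf => // _ [q Aq <-].
      rewrite ler_pdivrMl //.
      have [[_ qZ _] _] := svalP q.
      exact: le_trans (qle _ _ Aq (DZ a Dx)) (qZ _ _ a0' Dx).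
    + apply/eqP; rewrite eq_le; apply/andP; split; last first.
        rewrite ge_max; apply/andP; split; apply: lb_le_inf => // _ [q Aq <-].
          have [[_ _ qJ] _] := svalP q.
          by rewrite qJ // le_max (qle _ _ Aq Dx).
        have [[_ _ qJ] _] := svalP q.
        by rewrite qJ // le_max (qle _ _ Aq Dy) orbT.
      rewrite leNgt; apply/negP => hlt.
      have [q [Aq qx qy]] := @common x y _ _ Dx Dy (le_lt_trans (le_max_l _ _) hlt)
        (le_lt_trans (le_max_r _ _) hlt).
      have [[_ _ qJ] _] := svalP q.
      have := qle _ _ Aq (DJ Dx Dy); rewrite qJ // maxElt; case: ifP => _; lra.
  have infp y : D y -> inf (S y) <= p1 y.
    move=> Dy; apply: le_trans (qle _ _ Aa0 Dy) _.
    by have [_] := svalP a0; exact.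
  exists (mk _ infm infp) => q Aq; apply/asboolP => y Dy /=.
  exact: qle.
have [qm qp1] := svalP q; have [qA qZ qJ] := qm.
have qadd u y : D u -> D y -> sval q (y + u) = sval q y + sval q u.
  move=> Du Dy; apply/eqP; rewrite eq_le qA //=.
  have [r [rm rq rs]] := maxsublinear_step qm Du.
  have rp1 z : D z -> r z <= p1 z by move=> Dz; exact: le_trans (rq _ Dz) (qp1 _ Dz).
  have /qmax /asboolP h : Rl q (mk r rm rp1) by apply/asboolP.
  have := h y Dy; have := rs y 1 ler01 Dy; rewrite scale1r mul1r /=; lra.
have qopp u : D u -> sval q (- u) = - sval q u.
  move=> Du; have := qadd _ _ Du (DN Du).
  by rewrite addNr maxsublinear0 //; lra.
exists (sval q); split.
- split=> [x y Dx Dy|a x Dx|x y Dx Dy]; [exact: qadd| |exact: qJ].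
  have [a0|a0|->] := ltgtP a 0.
  + rewrite -[a]opprK scaleNr qopp; last exact: DZ.
    by rewrite (maxsublinear_scale qm) ?oppr_gt0 //; ring.
  + exact: maxsublinear_scale.
  + by rewrite scale0r mul0r maxsublinear0.
- by move=> y Dy; exact: le_trans (qp1 _ Dy) (p1p _ Dy).
- apply/eqP; rewrite eq_le; apply/andP; split.
    exact: le_trans (qp1 _ Dx0) (p1p _ Dx0).
  have := p1x (- x0) 1 ler01 (DN Dx0); have := qp1 _ (DN Dx0).
  rewrite scale1r addNr maxsublinear0 // qopp //; lra.
Qed.

End Hom.
End Lattice.

(** * Reduction of inequalities in principal ideals to real numbers *)

Section Transfer.
Variables (R : realType) (X : completeNormedModType R).
Variables (le : X -> X -> Prop) (join : X -> X -> X).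
Hypothesis H : is_banach_lattice le join.
Local Notation labs := (labs join).
Implicit Types (x y z e u : X) (a b r s : R).

Let lexx' := blle_refl H.
Let lej := bljoinl H.
Let rej := bljoinr H.
Hint Resolve lexx' lej rej : core.

(** This is the principal ideal generated by [e], in which [e] is an order unit. *)
Definition ideal e : set X :=
  [set x | exists r, [/\ 0 <= r, le x (r *: e) & le (- x) (r *: e)]].

Section Ideal.
Variable e : X.
Hypothesis e0 : le 0 e.

Lemma ideal0 : ideal e 0.
Proof. by exists 0; rewrite oppr0 scale0r. Qed.

Lemma ideal_sublattice : sublattice join (ideal e).
Proof.
split=> [x y [r [r0 h1 h2]] [s [s0 h3 h4]]|a x [r [r0 h1 h2]]|x y [r [r0 h1 h2]] [s [s0 h3 h4]]].
- exists (r + s); rewrite addr_ge0 //; split=> //; rewrite ?opprD scalerDl;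
  exact: (blle_add H).
- exists (`|a| * r); rewrite mulr_ge0 //; split=> //; rewrite -scalerA.
    have [a0|a0] := leP 0 a; first by rewrite ger0_norm //; apply: (blle_scale H).
    rewrite ltr0_norm // -[a *: x]opprK -scaleNr -scalerN.
    by apply: (blle_scale H) => //; rewrite oppr_ge0 ltW.
  have [a0|a0] := leP 0 a.
    by rewrite ger0_norm // -scalerN; apply: (blle_scale H).
  by rewrite ltr0_norm // -scaleNr; apply: (blle_scale H) => //; rewrite oppr_ge0 ltW.
- have m : forall v, le v (r *: e) \/ le v (s *: e) -> le v (Num.max r s *: e).
    move=> v [h|h]; apply: (blle_trans H) h _; apply: (scale_blle H) => //;
    by rewrite le_max lexx ?orbT.
  exists (Num.max r s); split; first by rewrite le_max r0.
    by apply: (bljoin_lub H); apply: m; [left|right].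
  by apply: (blle_trans H) (m _ (or_introl h2)); exact: (blle_opp H).
Qed.

Lemma ideal_labs x : le (labs x) e -> ideal e x.
Proof.
move=> h; exists 1; rewrite ler01 scale1r; split=> //; apply: (blle_trans H) h;
[exact: (labs_ge H)|exact: (labs_geN H)].
Qed.

Lemma ideal_ge0 x : le 0 x -> le x e -> ideal e x.
Proof. by move=> x0 xe; apply: ideal_labs; rewrite (ge0_labs H). Qed.

(** The positive part of [x] lies below every [r *: e], so its norm is at most [r] times the norm of
    [e], for every positive [r]. *)
Lemma arch x : (forall r, 0 < r -> le x (r *: e)) -> le x 0.
Proof.
move=> h; suff : `|join x 0| == 0.
  by rewrite normr_eq0 => /eqP <-.
rewrite eq_le normr_ge0 andbT; apply/ler_addgt0Pr => r r0; rewrite add0r.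
have d0 : 0 < 1 + `|e| by have := normr_ge0 e; lra.
apply: (@le_trans _ _ `|(r / (1 + `|e|)) *: e|).
  apply: (norm_blge0 H) => //; apply: (bljoin_lub H).
    by apply: h; rewrite divr_gt0.
  by apply: (scale_blge0 H) => //; rewrite divr_ge0 // ltW.
have rd : 0 <= r / (1 + `|e|) by rewrite divr_ge0 // ltW.
rewrite normrZ (ger0_norm rd) -mulrA ger_pMr // mulrC ler_pdivrMr // mul1r; lra.
Qed.

Definition gauge x := inf [set r | le x (r *: e)].

Lemma gauge_maxsublinear : e <> 0 -> maxsublinear join (ideal e) gauge.
Proof.
move=> eN0.
pose S x := [set r | le x (r *: e)].
have Sn x : ideal e x -> S x !=set0 by move=> [r [_ h _]]; exists r.
have Slb x : ideal e x -> exists c, forall v, S x v -> c <= v.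
  (* A value [v] below [- r] would give [0 <= (r + v) *: e] with a negative factor, forcing
     [e = 0]. *)
  move=> [r [_ _ h]]; exists (- r) => v /= Sv; rewrite leNgt; apply/negP => hv.
  have : le 0 ((r + v) *: e).
    by rewrite -(subrr x) addrC scalerDl; exact: (blle_add H).
  have rv : r + v < 0 by lra.
  move=> /(blle_scale H (_ : 0 <= - (r + v)^-1)) => h'.
  apply: eN0; apply: (blle_anti H) => //.
  have := h' _; rewrite scaler0 scalerA mulNr mulVf ?lt_eqF // scaleN1r.
  rewrite oppr_ge0 invr_le0 => /(_ (ltW rv)) /(blle_opp H).
  by rewrite opprK oppr0.
have gle x r : ideal e x -> le x (r *: e) -> gauge x <= r.
  by move=> /Slb[c hc] h; exact: (inf_lb_le hc h).
have glt x r : ideal e x -> gauge x < r -> le x (r *: e).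
  move=> Dx /inf_lt -/(_ (Sn _ Dx))[s hs sr]; apply: (blle_trans H) hs _.
  exact: (scale_blle H) (ltW sr).
have [IA IZ IJ] := ideal_sublattice.
split=> [x y Dx Dy|a x a0 Dx|x y Dx Dy].
- apply/ler_addgt0Pr => eps eps0.
  apply: gle; first exact: IA.
  rewrite (_ : _ + _ + _ = (gauge x + eps / 2) + (gauge y + eps / 2)); last by field.
  by rewrite scalerDl; apply: (blle_add H); apply: glt => //; lra.
- rewrite -ler_pdivrMl //; apply: lb_le_inf; first exact: Sn.
  move=> r hr; rewrite ler_pdivrMl //; apply: gle; first exact: IZ.
  by rewrite -scalerA; apply: (blle_scale H) => //; exact: ltW.
- apply/eqP; rewrite eq_le; apply/andP; split; last first.
    rewrite ge_max; apply/andP; split; apply: lb_le_inf; do ?exact/Sn/IJ.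
      by move=> r hr; apply: gle => //; apply: (blle_trans H) hr.
    by move=> r hr; apply: gle => //; apply: (blle_trans H) hr.
  apply/ler_addgt0Pr => eps eps0; apply: gle; first exact: IJ.
  by apply: (bljoin_lub H); apply: glt => //; rewrite maxElt; case: ifP => h; lra.
Qed.

(** Some lattice homomorphism attains the gauge at [x - y]. If all of them are nonpositive there,
    the gauge is nonpositive, and the Archimedean property yields [x - y <= 0]. *)
Lemma transfer x y : ideal e x -> ideal e y ->
  (forall phi, lathom join (ideal e) phi -> phi x <= phi y) -> le x y.
Proof.
move=> Dx Dy h; have [IA IZ IJ] := ideal_sublattice.
have Dxy : ideal e (x - y) by apply: IA => //; rewrite -scaleN1r; exact: IZ.
apply/(blsubr_ge0 H); rewrite -opprB -[0]oppr0; apply: (blle_opp H).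
have [e00|/eqP eN0] := eqVneq e 0.
  by have [r [_]] := Dxy; rewrite e00 scaler0.
have [phi [[pA pZ pJ] _ pxy]] :=
  lathom_exists H ideal_sublattice ideal0 (gauge_maxsublinear eN0) Dxy.
have hp : phi x <= phi y by apply: h; split.
have g0 : gauge (x - y) <= 0.
  rewrite -pxy pA //; last by rewrite -scaleN1r; exact: IZ.
  by rewrite -scaleN1r pZ //; lra.
apply: arch => r r0.
have /inf_lt -/(_ _)[] : gauge (x - y) < r by apply: le_lt_trans g0 r0.
  by have [r1 [_ h1 _]] := Dxy; exists r1.
move=> s hs sr; apply: (blle_trans H) hs _.
exact: (scale_blle H) (ltW sr).
Qed.

Lemma transfer_eq x y : ideal e x -> ideal e y ->
  (forall phi, lathom join (ideal e) phi -> phi x = phi y) -> x = y.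
Proof.
by move=> Dx Dy h; apply: (blle_anti H); apply: transfer => // phi /h ->.
Qed.

End Ideal.

Section LatHom.
Variables (D : set X) (phi : X -> R).
Hypotheses (DS : sublattice join D) (D0 : D 0) (ph : lathom join D phi).

Lemma sub_opp x : D x -> D (- x).
Proof. by case: DS => _ h _; rewrite -scaleN1r; exact: h. Qed.

Lemma sub_add x y : D x -> D y -> D (x + y).
Proof. by case: DS => h _ _; exact: h. Qed.

Lemma sub_scale a x : D x -> D (a *: x).
Proof. by case: DS => _ h _; exact: h. Qed.

Lemma sub_join x y : D x -> D y -> D (join x y).
Proof. by case: DS => _ _ h; exact: h. Qed.

Lemma sub_labs x : D x -> D (labs x).
Proof. by move=> Dx; apply: sub_join => //; exact: sub_opp. Qed.

Lemma sub_sum (I : Type) (s : seq I) (P : pred I) (F : I -> X) :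
  (forall i, P i -> D (F i)) -> D (\sum_(i <- s | P i) F i).
Proof. by move=> h; apply: big_ind => //; exact: sub_add. Qed.

Lemma phi_add x y : D x -> D y -> phi (x + y) = phi x + phi y.
Proof. by case: ph => h _ _; exact: h. Qed.

Lemma phi_scale a x : D x -> phi (a *: x) = a * phi x.
Proof. by case: ph => _ h _; exact: h. Qed.

Lemma phi_join x y : D x -> D y -> phi (join x y) = Num.max (phi x) (phi y).
Proof. by case: ph => _ _ h; exact: h. Qed.

Lemma phi0 : phi 0 = 0.
Proof. by rewrite -(scale0r (0 : X)) phi_scale // mul0r. Qed.

Lemma phi_opp x : D x -> phi (- x) = - phi x.
Proof. by move=> Dx; rewrite -scaleN1r phi_scale // mulN1r. Qed.

Lemma phi_sub x y : D x -> D y -> phi (x - y) = phi x - phi y.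
Proof. by move=> Dx Dy; rewrite phi_add ?phi_opp //; exact: sub_opp. Qed.

Lemma phi_labs x : D x -> phi (labs x) = `|phi x|.
Proof.
move=> Dx; rewrite /Defs.labs phi_join ?phi_opp //; last exact: sub_opp.
by rewrite /Num.max; case: ifP => h; [rewrite ltr0_norm|rewrite ger0_norm]; lra.
Qed.

Lemma phi_ge0 x : D x -> le 0 x -> 0 <= phi x.
Proof. by move=> Dx x0; rewrite -(ge0_labs H x0) phi_labs. Qed.

Lemma phi_sum (I : Type) (s : seq I) (P : pred I) (F : I -> X) :
  (forall i, P i -> D (F i)) ->
  phi (\sum_(i <- s | P i) F i) = \sum_(i <- s | P i) phi (F i).
Proof.
move=> h.
suff : D (\sum_(i <- s | P i) F i) /\
    phi (\sum_(i <- s | P i) F i) = \sum_(i <- s | P i) phi (F i) by case.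
apply: (big_ind2 (fun x v => D x /\ phi x = v)) => [|x v y v' [Dx <-] [Dy <-]|i /h].
- by split=> //; exact: phi0.
- by split; [exact: sub_add|exact: phi_add].
- by [].
Qed.

End LatHom.

Definition blmeet x y := - join (- x) (- y).

Lemma blmeetl x y : le (blmeet x y) x.
Proof. by rewrite -[X in le _ X]opprK; exact: (blle_opp H). Qed.

Lemma blmeetr x y : le (blmeet x y) y.
Proof. by rewrite -[X in le _ X]opprK; exact: (blle_opp H). Qed.

Lemma blmeet_glb z x y : le z x -> le z y -> le z (blmeet x y).
Proof.
move=> zx zy; rewrite -[z]opprK; apply: (blle_opp H); apply: (bljoin_lub H);
exact: (blle_opp H).
Qed.

Lemma blmeetC x y : blmeet x y = blmeet y x.
Proof. by rewrite /blmeet (bljoinC H). Qed.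

Lemma blmeet_ge0 x y : le 0 x -> le 0 y -> le 0 (blmeet x y).
Proof. exact: blmeet_glb. Qed.

Lemma blmeet0_le x y z : le 0 x -> le 0 z -> le x y -> blmeet y z = 0 -> blmeet x z = 0.
Proof.
move=> x0 z0 xy yz; apply: (blle_anti H); last exact: blmeet_ge0.
rewrite -yz; apply: blmeet_glb (blmeetr _ _); exact: (blle_trans H) (blmeetl _ _) xy.
Qed.

Lemma blmeet_scale a x y : 0 <= a -> blmeet (a *: x) (a *: y) = a *: blmeet x y.
Proof. by move=> a0; rewrite /blmeet scalerN (bljoin_scale H) // !scalerN. Qed.

(** In the ideal of the modulus of [x] the identity reduces to a case check on a real number [v]. *)
Lemma blmeet_posneg x : blmeet (join x 0) (join (- x) 0) = 0.
Proof.
have := labs_ge0 H x; set e := labs x => e0.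
have DS := ideal_sublattice e0; have D0 := ideal0 e.
have Dx : ideal e x by apply: ideal_labs.
have DN := sub_opp DS Dx.
have D1 := sub_join DS Dx D0; have D2 := sub_join DS DN D0.
apply: (transfer_eq e0) => //.
  exact/(sub_opp DS)/(sub_join DS)/(sub_opp DS)/D2/(sub_opp DS).
move=> phi ph; rewrite /blmeet (phi_opp ph); last exact/(sub_join DS)/(sub_opp DS)/D2/(sub_opp DS).
rewrite (phi_join ph); [|exact: (sub_opp DS)..].
rewrite !(phi_opp ph) // !(phi_join ph) // (phi_opp ph) // (phi0 D0 ph) //.
rewrite /Num.max; do !case: ifP => //; move: (phi x) => v; lra.
Qed.

Definition disjseq (w : nat -> X) :=
  (forall k, le 0 (w k)) /\ (forall j k, j <> k -> blmeet (w j) (w k) = 0).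

(** A homomorphism sends disjoint vectors to numbers of which at most one is nonzero, so both sums
    have at most one nonzero term. *)
Lemma norm_sum_disj (I : finType) (c u : I -> R) : (forall k, 0 <= u k) ->
  (forall j k, j <> k -> Num.min (u j) (u k) = 0) ->
  `|\sum_k c k * u k| = \sum_k `|c k| * u k.
Proof.
move=> u0 d; have [all0|] := boolP [forall k, u k == 0].
  by rewrite !big1 ?normr0 // => k _; rewrite (eqP (forallP all0 k)) mulr0.
rewrite negb_forall => /existsP[j uj].
have uk k : k != j -> u k = 0.
  move=> /eqP kj; have := d _ _ kj; rewrite /Num.min; case: ifP => // _ uj0.
  by rewrite uj0 eqxx in uj.
rewrite (bigD1 j) //= big1 ?addr0; last by move=> k kj; rewrite uk // mulr0.
rewrite normrM (ger0_norm (u0 j)) (bigD1 j) //= big1 ?addr0 //.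
by move=> k kj; rewrite uk // mulr0.
Qed.

Lemma labs_sum_disj (w : nat -> X) n (c : nat -> R) : disjseq w ->
  labs (\sum_(k < n) c k *: w k) = \sum_(k < n) `|c k| *: w k.
Proof.
move=> [w0 wd]; pose e := \sum_(k < n) w k.
have e0 : le 0 e by apply: (sum_blge0 H).
have DS := ideal_sublattice e0; have D0 := ideal0 e.
have Dw (k : 'I_n) : ideal e (w k).
  by apply: ideal_ge0 => //; apply: (sum_blle_term H (F := fun k : 'I_n => w k)).
have Ds d : ideal e (\sum_(k < n) d k *: w k).
  by apply: (sub_sum DS D0) => k _; exact: (sub_scale DS).
apply: (transfer_eq e0) => //; first exact: sub_labs.
move=> phi ph; rewrite (phi_labs DS ph) // !(phi_sum DS D0 ph);
  try by move=> k _; exact: (sub_scale DS).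
under eq_bigr do rewrite (phi_scale ph) //.
under [RHS]eq_bigr do rewrite (phi_scale ph) //.
apply: (@norm_sum_disj _ (fun k : 'I_n => c k) (fun k : 'I_n => phi (w k))).
  by move=> k; exact: (phi_ge0 DS ph).
move=> j k jk.
have := congr1 phi (wd j k (fun h => jk (val_inj h))).
rewrite (phi0 D0 ph) /blmeet (phi_opp ph); last by apply: (sub_join DS); exact: (sub_opp DS).
rewrite (phi_join ph); [|exact: (sub_opp DS)..].
rewrite !(phi_opp ph) // => <-; rewrite /Num.min /Num.max; do !case: ifP; lra.
Qed.

(** By disjointness the modulus of a combination depends monotonically on the moduli of its
    coefficients. In particular disjoint sequences are unconditional with constant 1. *)
Lemma disj_norm_le (w : nat -> X) n (c d : nat -> R) : disjseq w ->
  (forall k, (k < n)%N -> `|c k| <= `|d k|) ->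
  `|\sum_(k < n) c k *: w k| <= `|\sum_(k < n) d k *: w k|.
Proof.
move=> wd cd; apply: (norm_labs_le H); rewrite !labs_sum_disj //.
by apply: (sum_blle H) => k _; apply: (scale_blle H); [case: wd|exact: cd].
Qed.

End Transfer.

(** * Representation in C(K) *)

Section Representation.
Variables (R : realType) (X : completeNormedModType R).
Variables (le : X -> X -> Prop) (join : X -> X -> X).
Hypothesis H : is_banach_lattice le join.
Local Notation labs := (labs join).
Implicit Types (x y z e u : X) (a b r s : R).

Let lexx' := blle_refl H.
Let lej := bljoinl H.
Let rej := bljoinr H.
Hint Resolve lexx' lej rej : core.

(** The start value [0] makes every finite join positive and does not change joins of nonempty
    families of positive vectors. *)
Fixpoint njoin (f : nat -> X) n := if n is m.+1 then join (njoin f m) (f m) else 0.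

Lemma njoin_ge0 f n : le 0 (njoin f n).
Proof. by elim: n => //= n IH; apply: (blle_trans H) IH _. Qed.

Lemma njoin_ge f n i : (i < n)%N -> le (f i) (njoin f n).
Proof.
elim: n => // n IH /=; rewrite ltnS leq_eqVlt => /predU1P[->//|/IH h].
exact: (blle_trans H) h _.
Qed.

Lemma njoin_lub f n u : le 0 u -> (forall i, (i < n)%N -> le (f i) u) ->
  le (njoin f n) u.
Proof.
move=> u0; elim: n => // n IH h; apply: (bljoin_lub H); last exact: h.
by apply: IH => i /ltnW; exact: h.
Qed.

Definition joins_bounded C := forall n (f : nat -> X),
  (forall i, (i < n)%N -> le 0 (f i) /\ `|f i| <= 1) -> `|njoin f n| <= C.

(* [cov r y]: [y] lies below a finite supremum of positive vectors of norm at
   most [r]; the infimum of such [r] is an equivalent M-norm. *)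
Inductive cov r : X -> Prop :=
| cov_base f y : le 0 f -> `|f| <= r -> le y f -> cov r y
| cov_join y z : cov r y -> cov r z -> cov r (join y z)
| cov_le y z : le y z -> cov r z -> cov r y.

Lemma cov_ge0 r y : cov r y -> 0 <= r.
Proof. by elim=> // f z _ fr _; exact: le_trans (normr_ge0 f) fr. Qed.

Lemma cov_mono r s y : r <= s -> cov r y -> cov s y.
Proof.
move=> rs; elim=> [f z f0 fr zf|z t _ hz _ ht|z t zt _ ht].
- by apply: (cov_base f0) => //; exact: le_trans rs.
- exact: cov_join.
- exact: cov_le zt ht.
Qed.

Lemma cov_norm x : cov `|x| x.
Proof.
apply: (@cov_base _ (labs x)); first exact: labs_ge0; last exact: (labs_ge H).
by rewrite (norm_labs H).
Qed.

(** Translations distribute over joins, so inductions on both coverings reduce the claim to two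
    single dominating vectors, which are added. *)
Lemma cov_add r s y z : cov r y -> cov s z -> cov (r + s) (y + z).
Proof.
move=> cy; elim: cy z => [f {}y f0 fr yf|{}y y' _ hy _ hy'|{}y y' yy' _ hy] z cz.
- elim: cz => [g {}z g0 gs zg|{}z z' _ hz _ hz'|{}z z' zz' _ hz].
  + apply: (@cov_base _ (f + g)); last exact: (blle_add H).
      by rewrite -[0]addr0; exact: (blle_add H).
    exact: le_trans (ler_normD _ _) (lerD fr gs).
  + by rewrite [y + _]addrC (bljoin_addr H) ![_ + y]addrC; exact: cov_join.
  + by apply: cov_le hz; exact: (blle_add H).
- by rewrite (bljoin_addr H); apply: cov_join; [exact: hy|exact: hy'].
- by apply: cov_le (hy _ cz); exact: (blle_add H).
Qed.

Lemma cov_scale a r y : 0 <= a -> cov r y -> cov (a * r) (a *: y).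
Proof.
move=> a0; elim=> [f z f0 fr zf|z t _ hz _ ht|z t zt _ ht].
- apply: (@cov_base _ (a *: f)); [exact: (scale_blge0 H)| |exact: (blle_scale H)].
  by rewrite normrZ ger0_norm // ler_wpM2l.
- by rewrite (bljoin_scale H) //; exact: cov_join.
- by apply: cov_le ht; exact: (blle_scale H).
Qed.

Lemma cov_njoin r y : cov r y -> exists n f,
  (forall i, (i < n)%N -> le 0 (f i) /\ `|f i| <= r) /\ le y (njoin f n).
Proof.
elim=> [f z f0 fr zf|z t _ [n [f [hf fz]]] _ [m [g [hg gt]]]|z t zt _ [n [f [hf ft]]]].
- exists 1%N, (fun=> f); split=> //=; apply: (blle_trans H) zf _; exact: rej.
- exists (n + m)%N, (fun i => if (i < n)%N then f i else g (i - n)%N); split=> [i ilt|].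
    case: ltnP => [/hf//|ni]; apply: hg; lia.
  set k := fun i : nat => _.
  apply: (bljoin_lub H).
    apply: (blle_trans H) fz _; apply: njoin_lub; first exact: njoin_ge0.
    move=> i ilt; have -> : f i = k i by rewrite /k ilt.
    apply: njoin_ge; lia.
  apply: (blle_trans H) gt _; apply: njoin_lub; first exact: njoin_ge0.
  move=> i ilt; have -> : g i = k (n + i)%N.
    by rewrite /k ifF; [congr g; lia|lia].
  apply: njoin_ge; lia.
- by exists n, f; split=> //; apply: (blle_trans H) ft.
Qed.

Lemma njoin_scale a f n : 0 <= a -> a *: njoin f n = njoin (fun i => a *: f i) n.
Proof. by move=> a0; elim: n => [|n IH] /=; rewrite ?scaler0 // (bljoin_scale H) // IH. Qed.

Lemma cov_bound C r y : joins_bounded C -> 0 < r -> cov r y -> `|join y 0| <= C * r.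
Proof.
move=> hC r0 /cov_njoin[n [f [hf fy]]].
apply: (@le_trans _ _ `|njoin f n|).
  by apply: (norm_blge0 H) => //; apply: (bljoin_lub H) => //; exact: njoin_ge0.
have : `|njoin (fun i => r^-1 *: f i) n| <= C.
  apply: hC => i /hf[fi0 fi1]; split.
    by apply: (scale_blge0 H) => //; rewrite invr_ge0 ltW.
  by rewrite normrZ gtr0_norm ?invr_gt0 // mulrC ler_pdivrMr // mul1r.
have r1 : 0 <= r^-1 by rewrite invr_ge0 ltW.
rewrite -(njoin_scale f n r1) normrZ gtr0_norm ?invr_gt0 //.
by rewrite mulrC ler_pdivrMr.
Qed.

(** This is a one-sided gauge that vanishes on negative vectors; it is compared with the norm by
    evaluating it at [labs x]. *)
Definition mnorm y := inf [set r | cov r y].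

Lemma mnorm_le r y : cov r y -> mnorm y <= r.
Proof. by move=> h; apply: (@inf_lb_le _ _ 0) => // v; exact: cov_ge0. Qed.

Lemma mnorm_lt r y : mnorm y < r -> cov r y.
Proof.
move=> /inf_lt -/(_ _)[]; first by exists `|y|; exact: cov_norm.
by move=> s hs sr; apply: cov_mono hs; exact: ltW.
Qed.

Lemma mnorm_maxsublinear : maxsublinear join setT mnorm.
Proof.
split=> [x y _ _|a x a0 _|x y _ _].
- apply/ler_addgt0Pr => eps eps0; apply: mnorm_le.
  rewrite (_ : _ + _ + _ = (mnorm x + eps / 2) + (mnorm y + eps / 2)); last by field.
  by apply: cov_add; apply: mnorm_lt; lra.
- rewrite -ler_pdivrMl //; apply: lb_le_inf; first by exists `|x|; exact: cov_norm.
  move=> r hr; rewrite ler_pdivrMl //; apply: mnorm_le.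
  by apply: cov_scale => //; exact: ltW.
- apply/eqP; rewrite eq_le; apply/andP; split; last first.
    rewrite ge_max; apply/andP; split; apply: lb_le_inf;
      try by exists `|join x y|; exact: cov_norm.
      by move=> r hr; apply: mnorm_le; apply: cov_le hr.
    by move=> r hr; apply: mnorm_le; apply: cov_le hr.
  apply/ler_addgt0Pr => eps eps0; apply: mnorm_le.
  by apply: cov_join; apply: mnorm_lt; rewrite maxElt; case: ifP => h; lra.
Qed.

(** With the topology of pointwise convergence this is the compact space [K] of the
    representation. *)
Definition hom_ball : set {ptws X -> R} :=
  [set phi | lathom join setT phi /\ forall x, `|phi x| <= `|x|].

Lemma eval_continuous x : continuous (fun phi : {ptws X -> R} => phi x).
Proof. exact: (@proj_continuous X (fun _ : X => R) x). Qed.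

(** It sits in a product of compact intervals, and each homomorphism identity is a closed condition
    on finitely many evaluations. *)
Lemma hom_ball_compact : compact hom_ball.
Proof.
have cp : compact [set phi : {ptws X -> R} | forall x, `[- `|x|, `|x|]%classic (phi x)].
  exact: (@tychonoff X (fun _ : X => R) (fun x => `[- `|x|, `|x|]%classic)
    (fun x => @segment_compact _ _ _)).
apply: (subclosed_compact _ cp); last first.
  by move=> phi [_ h] x /=; rewrite in_itv /= -ler_norml.
have -> : hom_ball =
  (\bigcap_(p in [set: X * X]) [set phi : {ptws X -> R} | phi (p.1 + p.2) - phi p.1 - phi p.2 = 0]) `&`
  (\bigcap_(p in [set: R * X]) [set phi : {ptws X -> R} | phi (p.1 *: p.2) - p.1 * phi p.2 = 0]) `&`
  (\bigcap_(p in [set: X * X]) [set phi : {ptws X -> R} |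
      phi (join p.1 p.2) - Num.max (phi p.1) (phi p.2) = 0]) `&`
  (\bigcap_(x in [set: X]) [set phi : {ptws X -> R} | `|phi x| <= `|x|]).
  apply/seteqP; split=> [phi [[pA pZ pJ] pn]|phi [[[pA pZ] pJ] pn]].
    split; [split; [split|]|] => [p _|p _|p _|x _] /=.
    + by rewrite pA //; ring.
    + by rewrite pZ //; ring.
    + by rewrite pJ // subrr.
    + exact: pn.
  split=> [|x]; last exact: pn.
  split=> [x y _ _|a x _|x y _ _].
  + have /= := pA (x, y) I; lra.
  + have /= := pZ (a, x) I; lra.
  + by have /= /eqP := pJ (x, y) I; rewrite subr_eq0 => /eqP.
have cl0 (g : {ptws X -> R} -> R) : continuous g -> closed [set phi | g phi = 0].
  move=> cg; have -> : [set phi | g phi = 0] = g @^-1` [set 0] by [].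
  by apply: preimage_closed => [phi _|]; [exact: cg|exact: closed_eq].
have cB (f g : {ptws X -> R} -> R) : continuous f -> continuous g ->
    continuous (fun phi => f phi - g phi).
  by move=> cf cg phi; apply: (@cvgB _ R^o _ (nbhs phi) _ f g); [exact: cf|exact: cg].
have ev := eval_continuous.
apply: closedI; [apply: closedI; [apply: closedI|]|]; apply: closed_bigI.
- by move=> p _; apply: (cl0 _ (cB _ _ (cB _ _ (ev _) (ev _)) (ev _))).
- move=> p _; apply: (cl0 _ (cB _ _ (ev _) _)) => phi.
  by apply: (@cvgM _ _ (nbhs phi) _ (fun=> p.1)); [exact: cvg_cst|exact: ev].
- move=> p _; apply: (cl0 _ (cB _ _ (ev _) _)) => phi.
  by apply: (@continuous_max _ _ (fun psi : {ptws X -> R} => psi p.1) (fun psi => psi p.2)); exact: ev.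
- move=> x _; apply: (@preimage_closed _ _ (fun psi : {ptws X -> R} => `|psi x|) [set v | v <= `|x|]).
    move=> phi _; apply: continuous_comp; [exact: eval_continuous|exact: norm_continuous].
  exact: closed_le.
Qed.

Lemma joins_bounded_AM C : joins_bounded C -> lattice_iso_to_AM_space join.
Proof.
move=> hC.
exists (set_type hom_ball : topologicalType), (fun x t => set_val t x).
have tP (t : hom_ball) : hom_ball (set_val t) by exact: set_valP.
split; [|split; [|split; [|split; [|split]]]].
- move=> s t st; apply: val_inj.
  have hp : hausdorff_space {ptws X -> R}.
    by apply: (@hausdorff_product X (fun _ : X => R)) => x; exact: norm_hausdorff.
  apply: hp => A B nA nB.
  have cv := @initial_continuous (set_type hom_ball) {ptws X -> R} set_val.
  by have [u [uA uB]] := st _ _ (cv s A nA) (cv t B nB); exists (set_val u).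
- move=> F FF _.
  have hF : F (set_val @^-1` hom_ball).
    by apply: (@filterS _ F _ setT) filterT => t _; exact: tP.
  have [phi [hphi cl]] := @hom_ball_compact (set_val @ F) _ hF.
  exists (exist _ phi (mem_set hphi)); split=> // A B FA [_ [[W oW <-] Wphi sWB]].
  have FA' : F (set_val @^-1` (set_val @` A)).
    by apply: (@filterS _ F _ A) FA => a Aa; exists a.
  have [_ [[a Aa <-] Wa]] := cl (set_val @` A) W FA' (open_nbhs_nbhs (conj oW Wphi)).
  by exists a; split=> //; exact: sWB.
- move=> x t; apply: (@continuous_comp _ {ptws X -> R} _ set_val (fun psi : {ptws X -> R} => psi x)).
    exact: initial_continuous.
  exact: eval_continuous.
- by move=> a x y t; have [[pA pZ _] _] := tP t; rewrite pA ?pZ.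
- by move=> x y t; have [[_ _ pJ] _] := tP t; rewrite pJ.
pose C' := `|C| + 1.
have C'0 : 0 < C' by rewrite /C'; have := normr_ge0 C; lra.
exists C'^-1, 1; rewrite invr_gt0; split=> //; split=> // x; split=> [t|].
  by rewrite mul1r; have [_] := tP t; exact.
have TS : sublattice join [set: X] by split.
(* A homomorphism attaining the gauge at [labs x] is a point of [K] at which the image of [x] is at
   least the norm of [x] divided by [C']. *)
have [phi [ph phle phx]] :=
  lathom_exists H TS I mnorm_maxsublinear (I : [set: X] (labs x)).
have phn y : `|phi y| <= `|y|.
  rewrite ler_norml; apply/andP; split.
    rewrite lerNl -(phi_opp ph) // -normrN; apply: le_trans (phle _ I) _.
    exact/mnorm_le/cov_norm.
  by apply: le_trans (phle _ I) _; exact/mnorm_le/cov_norm.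
have hx : `|x| <= C' * `|phi x|.
  (* The slack [r] supplies a positive radius strictly above the infimum, as the covering bound
     requires. *)
  rewrite -(phi_labs TS ph) // phx -ler_pdivrMl //; apply/ler_addgt0Pr => r r0.
  rewrite ler_pdivrMl //.
  have m0 : 0 <= mnorm (labs x).
    by apply: lb_le_inf; [exists `|labs x|; exact: cov_norm|move=> v /cov_ge0].
  have := @cov_bound C (mnorm (labs x) + r) (labs x) hC _ (mnorm_lt _).
  rewrite (bljoin_idl H) ?(norm_labs H); last exact: (labs_ge0 H).
  move=> /(_ ltac:(lra) ltac:(lra)) /le_trans; apply.
  apply: ler_wpM2r; first lra.
  rewrite /C'; have := ler_norm C; lra.
rewrite ler_pdivrMl //; apply: le_trans hx _; rewrite ler_pM2l //.
apply: ub_le_sup.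
  by exists `|x| => _ [t _ <-]; have [_] := tP t; exact.
have hphi : hom_ball phi by [].
by exists (exist _ phi (mem_set hphi)).
Qed.

End Representation.

(** * A criterion for unconditional basic sequences *)

Section Unconditional.
Variables (R : realType) (X : completeNormedModType R).
Implicit Types (z : nat -> X) (a c d : nat -> R).

(** The intervals with centre [u i] and radius [e i] meet pairwise, so the supremum of their left
    ends lies in all of them. This provides limits of coefficients together with a rate. *)
Lemma nested_real (u e : nat -> R) :
  (forall i j, (i <= j)%N -> `|u i - u j| <= e i) -> exists l, forall i, `|u i - l| <= e i.
Proof.
move=> h; pose S := [set u i - e i | i in [set: nat]].
have hS i j : u i - e i <= u j + e j.
  have e0 k : 0 <= e k by have := h k k (leqnn k); rewrite subrr normr0.
  have := e0 i; have := e0 j; have [ij|/ltnW ji] := leqP i j.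
    by have := h _ _ ij; rewrite ler_norml; lra.
  by have := h _ _ ji; rewrite ler_norml; lra.
exists (sup S) => i; rewrite ler_norml; apply/andP; split.
  suff : sup S <= u i + e i by lra.
  by apply: ge_sup; [exists (u 0%N - e 0%N); exists 0%N|move=> _ [j _ <-]].
suff : u i - e i <= sup S by lra.
apply: ub_le_sup; last by exists i.
by exists (u 0%N + e 0%N) => _ [j _ <-].
Qed.

Lemma cvg_seqP (u : nat -> X) (y : X) : u @ \oo --> y <->
  forall e, 0 < e -> exists N, forall n, (N <= n)%N -> `|y - u n| <= e.
Proof.
split=> [/cvgrPdist_le h e /h[N _ hN]|h]; first by exists N => n /hN.
by apply/cvgrPdist_le => e /h[N hN]; exists N.
Qed.

Lemma sum_restrict z c (n m : nat) : (n <= m)%N ->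
  \sum_(k < m) ((k < n)%:R * c k) *: z k = \sum_(k < n) c k *: z k.
Proof.
move=> nm; rewrite (big_ord_widen _ (fun k => c k *: z k) nm) [RHS]big_mkcond.
by apply: eq_bigr => k _; case: ifP => _; rewrite ?mul1r ?mul0r ?scale0r.
Qed.

Lemma sum_supp z c (n m : nat) : (n <= m)%N -> (forall k, (n <= k)%N -> c k = 0) ->
  \sum_(k < m) c k *: z k = \sum_(k < n) c k *: z k.
Proof.
move=> nm c0; rewrite -(sum_restrict _ _ nm); apply: eq_bigr => k _.
by case: ltnP => [_|/c0 ->]; rewrite ?mul1r ?mulr0.
Qed.

Section Criterion.
Variables (z : nat -> X) (C : R).
Hypothesis z0 : forall k, z k != 0.
Hypothesis zC : forall m c (th : nat -> bool),
  `|\sum_(k < m) ((th k)%:R * c k) *: z k| <= C * `|\sum_(k < m) c k *: z k|.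

Lemma partial_le c (n m : nat) : (n <= m)%N ->
  `|\sum_(k < n) c k *: z k| <= C * `|\sum_(k < m) c k *: z k|.
Proof.
move=> nm; rewrite -(sum_restrict _ _ nm).
exact: (@zC m c (fun k => (k < n)%N)).
Qed.

Lemma coef_le c (m k : nat) : (k < m)%N ->
  `|c k| * `|z k| <= C * `|\sum_(j < m) c j *: z j|.
Proof.
move=> km; have := @zC m c (fun j => j == k).
suff -> : \sum_(j < m) ((nat_of_ord j == k)%:R * c j) *: z j = c k *: z k.
  by rewrite normrZ.
rewrite (bigD1 (Ordinal km)) //= eqxx mul1r big1 ?addr0 // => j jk.
by rewrite (_ : (_ == _) = false) ?mul0r ?scale0r //; apply: contraNF jk => /eqP jk; apply/eqP/val_inj.
Qed.

Lemma uncond_C_ge0 : 0 <= C.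
Proof.
have := @coef_le (fun=> 1) 1 0 (ltnSn 0); rewrite big_ord1 normr1 mul1r scale1r.
have : 0 < `|z 0%N| by rewrite normr_gt0.
move=> h; have : `|z 0%N| * 1 <= `|z 0%N| * C -> 1 <= C by rewrite ler_pM2l.
rewrite mulr1 mulrC; lra.
Qed.

Lemma expand_uniq a b y : expands z a y -> expands z b y -> b = a.
Proof.
move=> /cvg_seqP ha /cvg_seqP hb; apply/funext => k; apply/eqP.
rewrite -subr_eq0 -normr_eq0 eq_le normr_ge0 andbT.
have zk : 0 < `|z k| by rewrite normr_gt0.
rewrite -(ler_pM2r zk) mul0r; apply/ler_addgt0Pr => e e0; rewrite add0r.
have d0 : 0 < e / (2 * (C + 1)).
  by apply: divr_gt0 => //; have := uncond_C_ge0; lra.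
have [N hN] := ha _ d0; have [M hM] := hb _ d0.
pose m := (maxn (maxn N M) k.+1).
apply: le_trans (@coef_le (fun j => b j - a j) m k _) _; first by rewrite /m; lia.
have -> : \sum_(j < m) (b j - a j) *: z j =
    (y - \sum_(j < m) a j *: z j) - (y - \sum_(j < m) b j *: z j).
  under eq_bigr do rewrite scalerBl.
  rewrite sumrB; set A := \sum_(_ < _) _; set B := \sum_(_ < _) _.
  by rewrite opprB [RHS]addrC addrA subrK.
have := uncond_C_ge0 => C0.
apply: (@le_trans _ _ (C * (2 * (e / (2 * (C + 1)))))).
  rewrite ler_wpM2l // mulr_natl mulr2n; apply: le_trans (ler_normB _ _) _.
  by apply: lerD; [apply: hN|apply: hM]; rewrite /m; lia.
have -> : C * (2 * (e / (2 * (C + 1)))) = (C / (C + 1)) * e by field; lra.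
by rewrite -[X in _ <= X]mul1r ler_pM2r // ler_pdivrMr; lra.
Qed.

Lemma closed_span_approx y e : closed_span z y -> 0 < e ->
  exists p : nat * (nat -> R), (forall k, (p.1 <= k)%N -> p.2 k = 0) /\
    `|y - \sum_(k < p.1) p.2 k *: z k| <= e.
Proof.
move=> cy e0; have [_ [[n [a ->]] hb]] := cy (ball y e) (nbhsx_ballx y e e0).
exists (n, fun k => if (k < n)%N then a k else 0); split=> /= [k|].
  by rewrite leqNgt => /negbTE ->.
rewrite (eq_bigr (fun k : 'I_n => a k *: z k)) => [|k _]; last by rewrite ltn_ord.
by apply: ltW; move: hb; rewrite -ball_normE.
Qed.

Lemma small_inv (K e : R) j : 0 < e -> exists2 i, (j <= i)%N & K * i.+1%:R^-1 <= e.
Proof.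
move=> e0; exists (maxn j (Num.bound (`|K| / e))); first exact: leq_maxl.
set i := maxn _ _; rewrite ler_pdivrMr // mulrC -ler_pdivrMr //.
have h : `|K| / e < (Num.bound (`|K| / e))%:R.
  by apply: archi_boundP; rewrite divr_ge0 // ltW.
apply: (@le_trans _ _ (`|K| / e)); first by rewrite ler_pM2r ?invr_gt0 // ler_norm.
by apply/ltW/(lt_le_trans h); rewrite ler_nat; apply: leqW; exact: leq_maxr.
Qed.

(** Finite approximants of [y] have Cauchy coefficients, because each coefficient is controlled by
    the norm of the sum. The limits of these coefficients are the expansion. *)
Lemma closed_span_expands y : closed_span z y -> exists a, expands z a y.
Proof.
move=> cy; have C0 := uncond_C_ge0.
pose eps i : R := i.+1%:R^-1.
have eps0 i : 0 < eps i by rewrite invr_gt0.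
have epsle i j : (i <= j)%N -> eps j <= eps i.
  by move=> ij; rewrite lef_pV2 ?posrE // ler_nat.
have [p hp] := choice (fun i => closed_span_approx cy (eps0 i)).
pose n i := (p i).1; pose q i := (p i).2.
have q0 i k : (n i <= k)%N -> q i k = 0 by case: (hp i) => h _; exact: h.
have qy i : `|y - \sum_(k < n i) q i k *: z k| <= eps i by case: (hp i).
have dist0 i j m : (n i <= m)%N -> (n j <= m)%N ->
    `|\sum_(k < m) (q i k - q j k) *: z k| <= eps i + eps j.
  move=> im jm; under eq_bigr do rewrite scalerBl.
  rewrite sumrB (sum_supp z im (q0 i)) (sum_supp z jm (q0 j)).
  set A := \sum_(_ < _) _; set B := \sum_(_ < _) _.
  have -> : A - B = (y - B) - (y - A) by rewrite opprB [RHS]addrC addrA subrK.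
  apply: le_trans (ler_normB _ _) _; rewrite addrC; apply: lerD; exact: qy.
have dist i j m : `|\sum_(k < m) (q i k - q j k) *: z k| <= C * (eps i + eps j).
  pose m' := maxn m (maxn (n i) (n j)).
  apply: le_trans (@partial_le (fun k => q i k - q j k) m m' _) _; first exact: leq_maxl.
  by rewrite ler_wpM2l //; apply: dist0; rewrite /m'; lia.
have coef k : exists l, forall i, `|q i k - l| * `|z k| <= 2 * C * eps i.
  have zk : 0 < `|z k| by rewrite normr_gt0.
  suff [l hl] : exists l, forall i, `|q i k - l| <= 2 * C * eps i / `|z k|.
    by exists l => i; have := hl i; rewrite ler_pdivlMr.
  apply: nested_real.
  move=> i j ij; rewrite ler_pdivlMr //.
  pose m' := maxn k.+1 (maxn (n i) (n j)).
  apply: le_trans (@coef_le (fun k => q i k - q j k) m' k _) _; first exact: leq_maxl.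
  have : `|\sum_(k < m') (q i k - q j k) *: z k| <= eps i + eps j.
    by apply: dist0; rewrite /m'; lia.
  have := epsle _ _ ij; nra.
have [a ha] := choice coef.
(* Since [a] is only a coefficientwise limit, the comparison passes through a later approximant
   [q j], where [j] depends on [m] so that replacing [q j] by [a] in [m] terms costs at most [e]. *)
have main i m : (n i <= m)%N -> 
    `|\sum_(k < m) a k *: z k - \sum_(k < n i) q i k *: z k| <= 2 * C * eps i.
  move=> nm; rewrite -(sum_supp _ nm); last by move=> k; exact: q0.
  apply/ler_addgt0Pr => e e0.
  have [j ij hj] := small_inv (2 * C * m%:R) i e0.
  have -> : \sum_(k < m) a k *: z k - \sum_(k < m) q i k *: z k =
     \sum_(k < m) (q j k - q i k) *: z k - \sum_(k < m) (q j k - a k) *: z k.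
    rewrite -!sumrB; apply: eq_bigr => k _.
    by rewrite -!scalerBl; congr (_ *: _); ring.
  apply: le_trans (ler_normB _ _) _; apply: lerD.
    apply: le_trans (dist _ _ _) _; have := epsle _ _ ij; nra.
  apply: le_trans (ler_norm_sum _ _ _) _.
  apply: (@le_trans _ _ (\sum_(k < m) 2 * C * eps j)).
    by apply: ler_sum => k _; rewrite normrZ; exact: ha.
  by rewrite sumr_const card_ord -[_ *+ m]mulr_natr mulrAC.
exists a; apply/cvg_seqP => e e0.
have [i _ hi] := small_inv (2 * C + 1) 0 e0.
exists (n i) => m nm; have := main i m nm; have := qy i.
set A := \sum_(_ < _) _; set B := \sum_(_ < _) _ => h1 h2.
have -> : y - B = (y - A) - (B - A) by rewrite opprB addrA subrK.
apply: le_trans (ler_normB _ _) _; move: hi; rewrite -/(eps i); nra.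
Qed.

Lemma rearrange_expands a y (s : nat -> nat) : bijective s -> expands z a y ->
  (fun n => \sum_(k < n) a (s k) *: z (s k)) @ \oo --> y.
Proof.
move=> [t st ts] /cvg_seqP ha; have C0 := uncond_C_ge0.
apply/cvg_seqP => e e0.
have d0 : 0 < e / (2 * C + 1) by apply: divr_gt0 => //; lra.
have [N hN] := ha _ d0.
(* From here on the first [n] rearranged terms include all original indices below [N]. The
   difference from the partial sum up to [N] is therefore a selection of terms between [N] and [m],
   which [zC] controls. *)
exists (\max_(j < N) (t j).+1) => n hn.
have tlt j : (j < N)%N -> (t j < n)%N.
  move=> jN; apply: leq_trans hn.
  exact: (@leq_bigmax _ (fun j : 'I_N => (t j).+1) (Ordinal jN)).
pose m := maxn N (\max_(k < n) (s k).+1).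
have slt k : (k < n)%N -> (s k < m)%N.
  move=> kn; apply: leq_trans (leq_maxr _ _).
  exact: (@leq_bigmax _ (fun k : 'I_n => (s k).+1) (Ordinal kn)).
pose F j := a j *: z j.
have re : \sum_(k < n) F (s k) = \sum_(j < m) ((t j < n)%:R * a j) *: z j.
  rewrite -(big_mkord xpredT (fun k => F (s k))) -(big_map s xpredT F).
  rewrite -(big_mkord xpredT (fun j => ((t j < n)%:R * a j) *: z j)).
  transitivity (\sum_(j <- [seq j <- index_iota 0 m | (t j < n)%N]) F j).
    apply: perm_big; apply: uniq_perm.
    - by rewrite map_inj_uniq ?iota_uniq //; exact: can_inj st.
    - by rewrite filter_uniq // iota_uniq.
    - move=> j; rewrite mem_filter mem_index_iota /=; apply/mapP/andP.
        by move=> [k]; rewrite mem_index_iota => /= kn ->; rewrite st kn slt.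
      by move=> [tn _]; exists (t j); rewrite ?ts // mem_index_iota.
  rewrite big_filter big_mkcond; apply: eq_bigr => j _.
  by case: ifP => _; rewrite ?mul1r ?mul0r ?scale0r.
rewrite -/(F _) re.
have Nm : (N <= m)%N by exact: leq_maxl.
have hth := @zC m (fun j => (N <= j)%:R * a j) (fun j => (t j < n)%N).
have e1 : \sum_(j < m) ((N <= j)%N%:R * a j) *: z j =
    \sum_(j < m) a j *: z j - \sum_(j < N) a j *: z j.
  rewrite -(sum_restrict _ _ Nm) -sumrB; apply: eq_bigr => j _.
  by rewrite -scalerBl; case: ltnP => _ /=; congr (_ *: _); ring.
have e2 : \sum_(j < m) ((t j < n)%:R * ((N <= j)%N%:R * a j)) *: z j =
    \sum_(j < m) ((t j < n)%:R * a j) *: z j - \sum_(j < N) a j *: z j.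
  rewrite -(sum_restrict _ _ Nm) -sumrB; apply: eq_bigr => j _.
  rewrite -scalerBl; congr (_ *: _).
  by case: (ltnP j N) => [/tlt ->|_]; rewrite /=; ring.
move: hth; rewrite e1 e2 => hth.
have := hN _ (leqnn N); have := hN _ Nm.
set A := \sum_(_ < N) _ in hth *; set B := \sum_(_ < m) a _ *: _ in hth *.
set D := \sum_(_ < m) _ in hth *; move=> h1 h2.
have -> : y - D = (y - A) - (D - A) by rewrite opprB addrA subrK.
apply: le_trans (ler_normB _ _) _.
have h3 : `|B - A| <= e / (2 * C + 1) + e / (2 * C + 1).
  have -> : B - A = (y - A) - (y - B) by rewrite opprB [RHS]addrC addrA subrK.
  apply: le_trans (ler_normB _ _) _; exact: lerD.
have h4 : e = (2 * C + 1) * (e / (2 * C + 1)) by field; lra.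
have h5 := ler_wpM2l C0 h3; move: hth h1 h2 h5 h4; move: (e / _) => r; lra.
Qed.

(** Uniform boundedness of all coordinate selections on finite sums gives existence, uniqueness and
    rearrangement of expansions; only this finite estimate is checked for the sequences built
    below. *)
Lemma unconditional_criterion : unconditional_basic_seq z.
Proof.
split; last by move=> y a _ ha s bs; exact: rearrange_expands.
split=> // y /closed_span_expands[a ha]; exists a; split=> // b hb.
exact: expand_uniq ha hb.
Qed.

End Criterion.
End Unconditional.

(** * Disjoint sequences *)

Section Disjoint.
Variables (R : realType) (X : completeNormedModType R).
Variables (le : X -> X -> Prop) (join : X -> X -> X).
Hypothesis H : is_banach_lattice le join.
Local Notation labs := (labs join).
Local Notation meet := (blmeet join).
Implicit Types (x y z e u : X).

Let lexx' := blle_refl H.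
Let lej := bljoinl H.
Let rej := bljoinr H.
Let mel := blmeetl H.
Let mer := blmeetr H.
Hint Resolve lexx' lej rej mel mer : core.

Definition spos x := le 0 x /\ x <> 0.

Lemma blmeet0_scale (a b : R) x y : 0 <= a -> 0 <= b -> le 0 x -> le 0 y ->
  meet x y = 0 -> meet (a *: x) (b *: y) = 0.
Proof.
move=> a0 b0 x0 y0 xy; apply: (blle_anti H).
  rewrite -(scaler0 _ (Num.max a b)) -xy -(blmeet_scale H); last by rewrite le_max a0.
  apply: (blmeet_glb H).
    by apply: (blle_trans H) (mel _ _) _; apply: (scale_blle H) => //; rewrite le_max lexx.
  by apply: (blle_trans H) (mer _ _) _; apply: (scale_blle H) => //; rewrite le_max lexx orbT.
by apply: (blmeet_ge0 H); apply: (scale_blge0 H).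
Qed.

(** The recursion carries the list of all earlier terms, and each new term is chosen disjoint from
    that list. Lists with a member outside [P] get the default value [0]. *)
Lemma disjoint_build (P : X -> Prop) :
  (forall s : seq X, (forall x, x \in s -> P x) ->
     exists a, P a /\ forall x, x \in s -> meet a x = 0) ->
  exists w : nat -> X, (forall k, P (w k)) /\
    forall j k, j <> k -> meet (w j) (w k) = 0.
Proof.
move=> h.
have h' (s : seq X) : exists a, (forall x, x \in s -> P x) ->
    P a /\ forall x, x \in s -> meet a x = 0.
  have [hs|hs] := pselect (forall x, x \in s -> P x); last by exists 0.
  by have [a ha] := h s hs; exists a.
have [F hF] := choice h'.
pose S n := iter n (fun s => F s :: s) [::].
have SP n x : x \in S n -> P x.
  elim: n x => // n IH x; rewrite /S iterS inE => /predU1P[->|]; last exact: IH.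
  by have [] := hF _ IH.
have Sin k n : (k < n)%N -> F (S k) \in S n.
  elim: n => // n IH; rewrite ltnS leq_eqVlt /S iterS inE => /predU1P[->|/IH ->].
    by rewrite eqxx.
  by rewrite orbT.
exists (fun k => F (S k)); split=> [k|j k]; first by have [] := hF _ (@SP k).
move=> /eqP; rewrite neq_ltn => /orP[jk|kj].
  by rewrite (blmeetC H); have [_] := hF _ (@SP k); apply; exact: Sin.
by have [_] := hF _ (@SP j); apply; exact: Sin.
Qed.

Definition is_atom e := spos e /\
  forall x y, spos x -> spos y -> le x e -> le y e -> meet x y <> 0.

(** Without an atom below [e], every nonzero positive vector below [e] contains two disjoint ones.
    Splitting the first piece again and again leaves second pieces that are pairwise disjoint. *)
Lemma atom_below e : spos e -> (exists2 a, is_atom a & le a e) \/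
  exists w : nat -> X, (forall k, spos (w k)) /\
    forall j k, j <> k -> meet (w j) (w k) = 0.
Proof.
move=> e0; have [[a aa ae]|noatom] := pselect (exists2 a, is_atom a & le a e).
  by left; exists a.
right; pose T := {x | spos x /\ le x e}.
have split (t : T) : exists p : T * T, [/\ le (sval p.1) (sval t),
    le (sval p.2) (sval t) & meet (sval p.1) (sval p.2) = 0].
  have [tp te] := svalP t.
  have [[x [y [xp yp xt yt xy]]]|no] := pselect (exists x y, [/\ spos x, spos y,
      le x (sval t), le y (sval t) & meet x y = 0]).
    pose mk v (vp : spos v) (vt : le v (sval t)) : T :=
      exist _ v (conj vp (blle_trans H vt te)).
    by exists (mk x xp xt, mk y yp yt).
  exfalso; apply: noatom; exists (sval t) => //; split=> // x y xp yp xt yt xy.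
  by apply: no; exists x, y.
have [f hf] := choice split.
pose E n := iter n (fun t => (f t).1) (exist _ e (conj e0 (lexx' e)) : T).
have Ele m n : (m <= n)%N -> le (sval (E n)) (sval (E m)).
  elim: n => [|n IH]; first by rewrite leqn0 => /eqP ->.
  rewrite leq_eqVlt => /predU1P[->//|/IH]; rewrite /E iterS -/(E n).
  by apply: (blle_trans H); have [] := hf (E n).
have disj j k : (j < k)%N -> meet (sval (f (E j)).2) (sval (f (E k)).2) = 0.
  move=> jk; have [_ _ d] := hf (E j); rewrite (blmeetC H).
  have [[p1 _] _] := svalP (f (E k)).2; have [[p2 _] _] := svalP (f (E j)).2.
  apply: (blmeet0_le H) (d) => //.
  have [_ h _] := hf (E k); apply: (blle_trans H) h _.
  by have := Ele j.+1 k jk; rewrite /E iterS.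
exists (fun n => sval (f (E n)).2); split=> [n|j k /eqP].
  by have [] := svalP (f (E n)).2.
by rewrite neq_ltn => /orP[/disj//|/disj]; rewrite (blmeetC H).
Qed.

(** An atom cannot meet both the positive part [p] and the negative part [q] of [f - 2 *: e]. If it
    missed [q], then [q <= 2 *: e] would give [q = 0] and [2 *: e <= f], contradicting the norms. *)
Lemma atom_bound e f : is_atom e -> `|e| = 1 -> le 0 f -> `|f| <= 1 ->
  meet (join (f - 2 *: e) 0) e = 0.
Proof.
move=> [[e0 eN0] ea] en f0 fn.
set p := join (f - 2 *: e) 0; set q := join (- (f - 2 *: e)) 0.
have pq : meet p q = 0 by exact: (blmeet_posneg H).
have p0 : le 0 p by exact: rej.
have q0 : le 0 q by exact: rej.
have [->//|/eqP pe] := eqVneq (meet p e) 0.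
have [qe|/eqP qe] := eqVneq (meet q e) 0; last first.
  have pe0 := blmeet_ge0 H p0 e0; have qe0 := blmeet_ge0 H q0 e0.
  exfalso; apply: (ea (meet p e) (meet q e)) => //.
  apply: (blmeet0_le H) (mel _ _) _ => //; rewrite (blmeetC H).
  by apply: (blmeet0_le H) (mel _ _) _ => //; rewrite (blmeetC H).
have q2e : le q (2 *: e).
  apply: (bljoin_lub H); last exact: (scale_blge0 H).
  rewrite opprB -[X in le _ X]subr0; apply: (blle_add H) => //.
  exact: (blle_opp H).
have q00 : le q 0.
  apply: (@blle_trans _ _ _ _ H (meet (1 *: q) (2 *: e))).
    by rewrite scale1r; exact: (blmeet_glb H).
  by rewrite blmeet0_scale.
have : le (2 *: e) f.
  apply/(blsubr_ge0 H); rewrite -[f - _]opprK -[0]oppr0; apply: (blle_opp H).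
  exact: (blle_trans H) (lej _ 0) q00.
move=> /(norm_blge0 H (scale_blge0 H (ler0n _ 2) e0)).
by rewrite normrZ en normr_nat mulr1 => /le_trans -/(_ _ fn); rewrite (ler_nat _ 2 1).
Qed.

(** If there is no infinite disjoint sequence, finitely many normalized atoms already meet every
    nonzero positive vector. Then [u], twice their sum, dominates all positive vectors of the unit
    ball. *)
Lemma disjoint_or_bounded :
  (exists w, disjseq le join w /\ forall k, `|w k| = 1) \/
  exists C, joins_bounded le join C.
Proof.
have [[w [wp wd]]|noseq] := pselect (exists w : nat -> X, (forall k, spos (w k)) /\
    forall j k, j <> k -> meet (w j) (w k) = 0).
  left; exists (fun k => `|w k|^-1 *: w k).
  have wn k : 0 < `|w k| by rewrite normr_gt0; apply/eqP; case: (wp k).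
  split; last by move=> k; rewrite normrZ normfV normr_id mulVf // gt_eqF.
  split=> [k|j k jk].
    by apply: (scale_blge0 H); [rewrite invr_ge0|case: (wp k)].
  by apply: blmeet0_scale; rewrite ?invr_ge0 //; [case: (wp j)|case: (wp k)|exact: wd].
right.
have [s [sa sd]] : exists s : seq X, (forall x, x \in s -> is_atom x /\ `|x| = 1) /\
    forall x, le 0 x -> (forall y, y \in s -> meet x y = 0) -> x = 0.
  apply: contrapT => no; apply: (noseq).
  have [|w [wP wd]] := @disjoint_build (fun x => is_atom x /\ `|x| = 1); last first.
    by exists w; split=> // k; case: (wP k) => -[].
  move=> s sP; have [x [x0 xN0 xs]] : exists x, [/\ le 0 x, x <> 0 &
      forall y, y \in s -> meet x y = 0].
    apply: contrapT => no'; apply: (no); exists s; split=> // x x0 xs.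
    by apply: contrapT => xN0; apply: no'; exists x.
  have [[a aa ax]|w] := atom_below (conj x0 xN0); last by exfalso; exact: noseq.
  have [[a0 aN0] aat] := aa.
  have an : 0 < `|a| by rewrite normr_gt0; apply/eqP.
  exists (`|a|^-1 *: a); split; [split|].
  - split.
      split; first by apply: (scale_blge0 H); rewrite ?invr_ge0.
      by move/eqP; rewrite scaler_eq0 invr_eq0 gt_eqF //= => /eqP.
    have back z : spos z -> le z (`|a|^-1 *: a) -> spos (`|a| *: z) /\ le (`|a| *: z) a.
      move=> [z0 zN0] za; split; last first.
        have := blle_scale H (ltW an) za.
        by rewrite scalerA mulfV ?scale1r // gt_eqF.
      split; first by apply: (scale_blge0 H).
      by move/eqP; rewrite scaler_eq0 gt_eqF //= => /eqP.
    move=> y z yp zp /(back _ yp)[yp' ya] /(back _ zp)[zp' za] yz.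
    by apply: (aat _ _ yp' zp' ya za); rewrite (blmeet_scale H) // yz scaler0.
  - by rewrite normrZ normfV normr_id mulVf // gt_eqF.
  - move=> y ys; have [[[y0 _] _] _] := sP y ys.
    rewrite -[y]scale1r; apply: blmeet0_scale; rewrite ?invr_ge0 //.
    exact: (blmeet0_le H) (xs y ys).
pose u := \sum_(e <- s) 2 *: e.
have u0 : le 0 u.
  by rewrite /u big_seq; apply: (sum_blge0 H) => e /sa[[[e0 _] _] _]; exact: (scale_blge0 H).
exists `|u| => n f hf; apply: (norm_blge0 H); first exact: (njoin_ge0 H).
apply: (njoin_lub H) => // i /hf[fi0 fi1].
suff h : join (f i - u) 0 = 0.
  by apply/(blsubr_ge0 H); rewrite -[u - _]opprK -[0]oppr0; apply: (blle_opp H); rewrite opprB -[X in le _ X]h.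
apply: sd => // e es; have [ea en] := sa e es.
apply: (blmeet0_le H) (atom_bound ea en fi0 fi1) => //; first by case: ea => -[].
apply: (bljoin_lub H) => //; apply: (blle_trans H) (lej _ 0).
apply: (blle_add H) => //; apply: (blle_opp H).
rewrite /u (big_rem e) //= -[2 *: e in X in le X _]addr0; apply: (blle_add H) => //.
rewrite big_seq; apply: (sum_blge0 H) => y /mem_rem /sa[[[y0 _] _] _].
exact: (scale_blge0 H).
Qed.

End Disjoint.

(** * Nearly disjoint pieces of a supremum *)

Section RunningMax.
Variable R : realType.
Implicit Types (u v : nat -> R) (V : R) (n L l : nat).

Fixpoint rmax u n : R := if n is m.+1 then Num.max (rmax u m) (u m) else 0.

Lemma rmax_ge0 u n : 0 <= rmax u n.
Proof. by elim: n => //= n IH; rewrite le_max IH. Qed.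

Lemma rmax_ge u n i : (i < n)%N -> u i <= rmax u n.
Proof.
elim: n => // n IH /=; rewrite ltnS leq_eqVlt => /predU1P[->|/IH h].
  by rewrite le_max lexx orbT.
by rewrite le_max h.
Qed.

Lemma rmax_attain u n : rmax u n = 0 \/ exists2 i, (i < n)%N & rmax u n = u i.
Proof.
elim: n => [|n IH] /=; first by left.
rewrite /Num.max; case: ifP => _; first by right; exists n.
by case: IH => [->|[i ilt ->]]; [left|right; exists i => //; exact: ltnW].
Qed.

Lemma eq_rmax u v n : (forall i, (i < n)%N -> u i = v i) -> rmax u n = rmax v n.
Proof.
elim: n => //= n IH h; rewrite IH ?h // => i ilt; apply: h; exact: ltnW.
Qed.

Lemma rmax0 u n : (forall i, (i < n)%N -> u i = 0) -> rmax u n = 0.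
Proof.
elim: n => //= n IH h; rewrite IH ?h ?maxxx // => i ilt; apply: h; exact: ltnW.
Qed.

(** The levels run from one half to one in [L] equal steps. *)
Definition thr L l : R := 2^-1 + l%:R / (2 * L%:R).
(** The slope is chosen so that the ramp rises from [0] at level [l] to [V] at level [l.+1]. *)
Definition cut L l v V i := Num.min V (2 * L%:R * Num.max (v i - thr L l * V) 0).
Definition incr u i := rmax u i.+1 - rmax u i.

(** At the first index where [u] equals [V], the running maximum makes its whole rise in a single
    increment. *)
Lemma incr_jump u n V : 0 < V -> (forall i, (i < n)%N -> u i = 0 \/ u i = V) ->
  (exists2 i, (i < n)%N & u i = V) -> V <= rmax (incr u) n.
Proof.
move=> V0 uV ex.
have ex' : exists i, (i < n)%N && (u i == V).
  by case: ex => i ilt ui; exists i; rewrite ilt ui eqxx.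
case: (ex_minnP ex') => j /andP[jn /eqP uj] jmin.
have r0 : rmax u j = 0.
  apply: rmax0 => i ij; have iln := ltn_trans ij jn.
  case: (uV i iln) => // ui; have := jmin i; rewrite iln ui eqxx => /(_ isT).
  by rewrite leqNgt ij.
have -> : V = incr u j.
  by rewrite /incr /= r0 uj subr0 /Num.max V0.
exact: rmax_ge.
Qed.

Lemma sum_bool_le1 n (b : nat -> bool) :
  (forall i j, (i < j)%N -> (j < n)%N -> b i -> b j -> False) ->
  \sum_(i < n) (b i)%:R <= 1 :> R.
Proof.
elim: n => [|n IH] h; first by rewrite big_ord0 ler01.
rewrite big_ord_recr /=; case bn : (b n); last first.
  by rewrite addr0; apply: IH => i j ij jn; apply: h ij (ltnW jn).
rewrite big1 ?add0r // => i _.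
by case bi : (b i) => //; exfalso; apply: (h i n).
Qed.

(* For at most one threshold does a given [v i] fall in the ramp of the cut-off,
   so for most thresholds the cut-offs only take the values [0] and [V]. *)
Lemma threshold_sum n L v V : (0 < L)%N -> (forall i, (i < n)%N -> 0 <= v i) ->
  V = rmax v n ->
  (L%:R - n%:R) * V <= \sum_(l < L) rmax (incr (cut L l v V)) n.
Proof.
move=> L0 v0 VE; have V0 : 0 <= V by rewrite VE; exact: rmax_ge0.
have L0' : 0 < L%:R :> R by rewrite ltr0n.
pose bad l i := (thr L l * V < v i) && (v i < thr L l.+1 * V).
have thrS l : thr L l.+1 = thr L l + (2 * L%:R)^-1.
  by rewrite /thr -natr1; field; rewrite gt_eqF.
(* With an index inside the ramp the left side is at most [0]. Otherwise all cut-offs are [0] or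
   [V], and the index attaining the maximum is cut to [V] because [thr L L] is one. *)
have step l : (l < L)%N ->
    (1 - \sum_(i < n) (bad l i)%:R) * V <= rmax (incr (cut L l v V)) n.
  move=> lL; have [/existsP[i bi]|] := boolP [exists i : 'I_n, bad l i].
    apply: (@le_trans _ _ 0); last exact: rmax_ge0.
    rewrite mulr_le0_ge0 // (bigD1 i) //= bi /=.
    have : 0 <= \sum_(j < n | j != i) (bad l j)%:R :> R by apply: sumr_ge0.
    lra.
  rewrite negb_exists => /forallP nb.
  rewrite big1 ?subr0 ?mul1r; last by move=> i _; rewrite (negbTE (nb i)).
  move: V0; rewrite le_eqVlt => /predU1P[<-|V0]; first exact: rmax_ge0.
  have cutV i : thr L l.+1 * V <= v i -> cut L l v V i = V.
    rewrite thrS => h; apply: min_idPl.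
    have h1 : V / (2 * L%:R) <= v i - thr L l * V by rewrite [V / _]mulrC; lra.
    have : V / (2 * L%:R) <= Num.max (v i - thr L l * V) 0 by rewrite le_max h1.
    by rewrite ler_pdivrMr 1?mulrC //; lra.
  apply: incr_jump => // [i ilt|].
    have [h|h] := leP (v i) (thr L l * V).
      left; rewrite /cut (max_idPr _) ?mulr0; last by lra.
      by rewrite minC; apply: min_idPl; exact: ltW.
    right; apply: cutV; have := nb (Ordinal ilt).
    by rewrite /bad /= h /= -leNgt.
  have [V00|[i ilt Vi]] := rmax_attain v n; first by move: V0; rewrite VE V00 ltxx.
  exists i => //; apply: cutV; rewrite -Vi -VE.
  rewrite -[X in _ <= X]mul1r ler_pM2r // /thr.
  have : l.+1%:R / (2 * L%:R) <= 2^-1 :> R.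
    rewrite ler_pdivrMr ?mulr_gt0 // mulrA mulVf ?mul1r ?ler_nat //.
  lra.
apply: (@le_trans _ _ (\sum_(l < L) (1 - \sum_(i < n) (bad l i)%:R) * V)); last first.
  by apply: ler_sum => l _; exact: step.
rewrite -mulr_suml ler_wpM2r // sumrB sumr_const card_ord lerB //.
rewrite exchange_big /=.
apply: (@le_trans _ _ (\sum_(i < n) 1)); last by rewrite sumr_const card_ord.
apply: ler_sum => i _.
apply: (@sum_bool_le1 L (fun l => bad l i)) => l l' ll' _.
move=> /andP[_ h1] /andP[h2 _]; have := lt_trans h2 h1; apply/negP.
rewrite -leNgt ler_wpM2r // /thr lerD2l ler_pM2r ?invr_gt0 ?mulr_gt0 //.
by rewrite ler_nat.
Qed.

End RunningMax.

(** * The cut-offs carried over to the lattice *)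

Section Disjointify.
Variables (R : realType) (X : completeNormedModType R).
Variables (le : X -> X -> Prop) (join : X -> X -> X).
Hypothesis H : is_banach_lattice le join.
Local Notation labs := (labs join).
Local Notation meet := (blmeet join).
Local Notation njoin := (njoin join).

Let lexx' := blle_refl H.
Let lej := bljoinl H.
Let rej := bljoinr H.
Let mel := blmeetl H.
Let mer := blmeetr H.
Hint Resolve lexx' lej rej mel mer : core.

Section Phi.
Variables (D : set X) (phi : X -> R).
Hypotheses (DS : sublattice join D) (D0 : D 0) (ph : lathom join D phi).

Lemma sub_njoin f n : (forall i, (i < n)%N -> D (f i)) -> D (njoin f n).
Proof.
elim: n => //= n IH h; apply: (sub_join DS); last exact: h.
by apply: IH => i ilt; apply: h; exact: ltnW.
Qed.

Lemma phi_njoin f n : (forall i, (i < n)%N -> D (f i)) ->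
  phi (njoin f n) = rmax (fun i => phi (f i)) n.
Proof.
elim: n => [|n IH] h /=; first exact: (phi0 D0 ph).
have h' i : (i < n)%N -> D (f i) by move=> ilt; apply: h; exact: ltnW.
by rewrite (phi_join ph) ?IH //; [exact: sub_njoin|exact: h].
Qed.

Lemma sub_meet x y : D x -> D y -> D (meet x y).
Proof. by move=> Dx Dy; apply/(sub_opp DS)/(sub_join DS); exact: (sub_opp DS). Qed.

Lemma phi_meet x y : D x -> D y -> phi (meet x y) = Num.min (phi x) (phi y).
Proof.
move=> Dx Dy; rewrite /blmeet (phi_opp ph); last by apply/(sub_join DS); exact: (sub_opp DS).
rewrite (phi_join ph); [|exact: (sub_opp DS)..].
by rewrite !(phi_opp ph) //; rewrite /Num.min /Num.max; do !case: ifP; lra.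
Qed.

End Phi.

(** The pieces are increments of the running join of cut-offs of [f i] at one level, so their sum
    telescopes below the join [F]. Averaging over the levels finds one at which the join of the
    pieces keeps half of the norm. *)
Lemma disjointify n (f : nat -> X) : (forall i, (i < n)%N -> le 0 (f i) /\ `|f i| <= 1) ->
  exists g : nat -> X, [/\ forall i, (i < n)%N -> le 0 (g i) /\ `|g i| <= 2,
    le (\sum_(i < n) g i) (njoin f n) & `|njoin f n| <= 2 * `|njoin g n|].
Proof.
case: n => [_|n hf].
  by exists (fun=> 0); split=> //=; rewrite ?big_ord0 // normr0 mulr0.
set N := n.+1; set F := njoin f N.
have F0 : le 0 F by exact: (njoin_ge0 H).
have DS := ideal_sublattice H F0; have D0 := ideal0 H F.
have DF : ideal le F F by apply: (ideal_ge0 H).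
have Df i : (i < N)%N -> ideal le F (f i).
  by move=> ilt; apply: (ideal_ge0 H); [case: (hf i ilt)|exact: (njoin_ge H)].
(* Pointwise at most [N] levels are lost to ramps, so half of the [2 * N] levels remain. *)
pose L := (2 * N)%N.
pose e l i := meet F ((2 * L%:R) *: join (f i - thr R L l *: F) 0).
pose E l i := njoin (e l) i.
pose g l i := E l i.+1 - E l i.
have De l i : (i < N)%N -> ideal le F (e l i).
  move=> ilt; apply: (sub_meet DS) => //; apply: (sub_scale DS); apply: (sub_join DS) => //.
  by apply: (sub_add DS); [exact: Df|apply: (sub_opp DS); exact: (sub_scale DS)].
have DE l i : (i <= N)%N -> ideal le F (E l i).
  move=> iN; apply: (sub_njoin DS) => // j ji; apply: De; exact: leq_trans iN.
have Dg l i : (i < N)%N -> ideal le F (g l i).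
  by move=> ilt; apply: (sub_add DS); [exact: DE|apply: (sub_opp DS); apply: DE; exact: ltnW].
have pe phi l i : lathom join (ideal le F) phi -> (i < N)%N ->
    phi (e l i) = cut L l (fun i => phi (f i)) (phi F) i.
  move=> ph ilt; have D1 : ideal le F (f i - thr R L l *: F).
    by apply: (sub_add DS); [exact: Df|apply: (sub_opp DS); exact: (sub_scale DS)].
  rewrite (phi_meet DS ph) //; last by apply: (sub_scale DS); exact: (sub_join DS).
  rewrite (phi_scale ph); last exact: (sub_join DS).
  rewrite (phi_join ph) // (phi0 D0 ph) (phi_sub DS ph) ?(phi_scale ph) //; first exact: Df.
  exact: (sub_scale DS).
have pF phi : lathom join (ideal le F) phi -> phi F = rmax (fun i => phi (f i)) N.
  by move=> ph; exact: (phi_njoin DS D0 ph).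
have e0 l i : le 0 (e l i).
  by apply: (blmeet_ge0 H) => //; apply: (scale_blge0 H) => //; rewrite -natrM.
have g0 l i : le 0 (g l i) by apply/(blsubr_ge0 H); exact: lej.
have ge l i : le (g l i) (e l i).
  apply/(blsubr_ge0 H); rewrite opprB addrA; apply/(blsubr_ge0 H); apply: (bljoin_lub H).
    by rewrite -[X in le X _]add0r; apply: (blle_add H).
  rewrite -[X in le X _]addr0; apply: (blle_add H) => //; exact: (njoin_ge0 H).
have ef l i : (i < N)%N -> le (e l i) (2 *: f i).
  move=> ilt; apply: (transfer H F0); [exact: De|apply: (sub_scale DS); exact: Df|].
  move=> phi ph; rewrite pe // (phi_scale ph); last exact: Df.
  have fi0 : 0 <= phi (f i) by apply: (phi_ge0 H DS ph); [exact: Df|case: (hf i ilt)].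
  have F0' : 0 <= phi F by exact: (phi_ge0 H DS ph).
  have t2 : 2^-1 <= thr R L l by rewrite /thr lerDl divr_ge0 // -natrM.
  rewrite /cut; have [h|h] := leP (phi (f i)) (thr R L l * phi F).
    rewrite (max_idPr _) ?mulr0; last lra.
    by rewrite ge_min (_ : 0 <= _) ?orbT //; lra.
  by rewrite ge_min; apply/orP; left; nra.
have gf l i : (i < N)%N -> `|g l i| <= 2.
  move=> ilt; apply: (@le_trans _ _ `|2 *: f i|).
    by apply: (norm_blge0 H) => //; apply: (blle_trans H) (ge _ _) (ef _ _ ilt).
  rewrite normrZ normr_nat -[X in _ <= X]mulr1 ler_pM2l //; by case: (hf i ilt).
have gF l : le (\sum_(i < N) g l i) F.
  rewrite -(big_mkord xpredT (g l)) telescope_sumr // subr0.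
  by apply: (njoin_lub H) => // i _; exact: mel.
have sumG : le (N%:R *: F) (\sum_(l < L) njoin (g l) N).
  have DG l : ideal le F (njoin (g l) N) by apply: (sub_njoin DS) => // i; exact: Dg.
  apply: (transfer H F0); [exact: (sub_scale DS)|exact: (sub_sum DS)|].
  move=> phi ph; rewrite (phi_scale ph) // (phi_sum DS D0 ph) //.
  have pf0 i : (i < N)%N -> 0 <= phi (f i).
    by move=> ilt; apply: (phi_ge0 H DS ph); [exact: Df|case: (hf i ilt)].
  have := @threshold_sum R N L (fun i => phi (f i)) (phi F) isT pf0 (pF phi ph).
  rewrite (_ : L%:R - N%:R = N%:R); last by rewrite /L natrM; ring.
  move=> /le_trans; apply.
  apply: ler_sum => l _; rewrite (phi_njoin DS D0 ph); last by move=> i; exact: Dg.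
  have pE i : (i <= N)%N -> phi (E l i) = rmax (cut L l (fun i => phi (f i)) (phi F)) i.
    move=> iN; rewrite (phi_njoin DS D0 ph) => [|j ji]; last exact/De/(leq_trans ji).
    by apply: eq_rmax => j ji; apply: pe => //; exact: leq_trans ji iN.
  rewrite (@eq_rmax _ _ (fun i => phi (g l i)) N) // => i ilt.
  rewrite /incr /g (phi_sub DS ph); [|exact: DE|apply: DE; exact: ltnW].
  by rewrite (pE _ ilt) (pE _ (ltnW ilt)).
have [l hl] : exists l : 'I_L, `|F| <= 2 * `|njoin (g l) N|.
  apply: contrapT => no.
  have no' (l : 'I_L) : `|njoin (g l) N| < `|F| / 2.
    rewrite ltNge; apply/negP => h; apply: no; exists l; lra.
  have : N%:R * `|F| <= \sum_(l < L) `|njoin (g l) N|.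
    apply: le_trans (ler_norm_sum _ _ _).
    rewrite -[N%:R]ger0_norm // -normrZ; apply: (norm_blge0 H) => //.
    exact: (scale_blge0 H).
  apply/negP; rewrite -ltNge.
  have -> : N%:R * `|F| = \sum_(l < L) `|F| / 2.
    by rewrite sumr_const card_ord -[_ *+ L]mulr_natr /L natrM; field.
  apply: ltr_sum => //; apply/hasP.
  by exists (Ordinal (isT : (0 < L)%N)); rewrite // mem_index_enum.
exists (g l); split=> //; move=> i ilt; split=> //; exact: gf.
Qed.

End Disjointify.

(** * Sign systems *)

Section Signs.
Variable R : realType.
Implicit Types (c d lam : nat -> R) (N n : nat).

Definition is_sign (x : R) := x = 1 \/ x = -1.

Lemma is_sign_sqr x : is_sign x -> x * x = 1.
Proof. by case=> ->; rewrite ?mulr1 // mulN1r opprK. Qed.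

Lemma is_sign_norm x : is_sign x -> `|x| = 1.
Proof. by case=> ->; rewrite ?normrN normr1. Qed.

(** The second clause is exact orthogonality, and the third is invariance of the distribution under
    sign changes. Both follow by doubling the index set. *)
Lemma rademacher N : exists r : nat -> nat -> R, [/\ forall k i, is_sign (r k i),
  forall c, \sum_(i < 2 ^ N) (\sum_(k < N) c k * r k i) ^+ 2 =
            (2 ^ N)%:R * \sum_(k < N) c k ^+ 2
& forall (G : R -> R) c (e : nat -> R), (forall k, is_sign (e k)) ->
  \sum_(i < 2 ^ N) G (\sum_(k < N) e k * c k * r k i) =
  \sum_(i < 2 ^ N) G (\sum_(k < N) c k * r k i)].
Proof.
elim: N => [|N [r [rs rsq rG]]].
  exists (fun _ _ => 1); split=> [k i|c|G c e _]; first by left.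
    by rewrite big_ord1 !big_ord0 mulr0 expr0n.
  by rewrite !big_ord1 !big_ord0.
(* The old signs are repeated on both halves and the new one separates the halves; changing its sign
   merely exchanges them. *)
pose r' k i := if (k < N)%N then r k (i %% 2 ^ N)%N else if (i < 2 ^ N)%N then 1 else -1.
have key (G : R -> R) c : \sum_(i < 2 ^ N.+1) G (\sum_(k < N.+1) c k * r' k i) =
    \sum_(i < 2 ^ N) (G (\sum_(k < N) c k * r k i + c N) +
                      G (\sum_(k < N) c k * r k i - c N)).
  rewrite (_ : (2 ^ N.+1 = 2 ^ N + 2 ^ N)%N); last by rewrite expnS mul2n addnn.
  rewrite big_split_ord /= -big_split /=; apply: eq_bigr => i _; congr (_ + _); congr G.
    rewrite big_ord_recr /= /r' ltnn ltn_ord mulr1; congr (_ + _).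
    by apply: eq_bigr => k _; rewrite ltn_ord modn_small.
  rewrite big_ord_recr /= /r' ltnn ltnNge leq_addr /= mulrN1; congr (_ - _).
  by apply: eq_bigr => k _; rewrite ltn_ord modnDl modn_small.
exists r'; split=> [k i|c|G c e es].
- by rewrite /r'; case: ifP => _; [exact: rs|case: ifP => _; [left|right]].
- rewrite (key (fun x => x ^+ 2)) big_ord_recr /=.
  rewrite (eq_bigr (fun i : 'I_(2 ^ N) => 2 * (\sum_(k < N) c k * r k i) ^+ 2 + 2 * c N ^+ 2));
    last by move=> i _; ring.
  rewrite big_split /= -mulr_sumr rsq sumr_const card_ord -[_ *+ (2 ^ N)]mulr_natl expnS natrM.
  by ring.
- rewrite (key G (fun k => e k * c k)) (key G c).
  pose G1 x := G (x + c N) + G (x - c N).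
  rewrite -(rG G1 c e es); apply: eq_bigr => i _; rewrite /G1.
  by case: (es N) => ->; rewrite ?mul1r // mulN1r opprK addrC.
Qed.

(** Each sign is chosen to make the cross term [T] with the preceding partial sum nonpositive. *)
Lemma greedy_signs N m (u : nat -> nat -> R) : exists e : nat -> R,
  (forall k, is_sign (e k)) /\
  \sum_(j < m) (\sum_(k < N) e k * u k j) ^+ 2 <= \sum_(k < N) \sum_(j < m) u k j ^+ 2.
Proof.
elim: N => [|N [e [es he]]].
  exists (fun=> 1); split=> [k|]; first by left.
  by rewrite big_ord0 big1 // => j _; rewrite big_ord0 expr0n.
pose T := \sum_(j < m) (\sum_(k < N) e k * u k j) * u N j.
have [s [ss sT]] : exists s, is_sign s /\ s * T <= 0.
  have [T0|T0] := leP T 0; first by exists 1; split; [left|rewrite mul1r].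
  by exists (-1); split; [right|lra].
exists (fun k => if (k < N)%N then e k else s); split=> [k|]; first by case: ifP.
rewrite big_ord_recr /=.
rewrite (eq_bigr (fun j : 'I_m => (\sum_(k < N) e k * u k j) ^+ 2 +
   2 * s * ((\sum_(k < N) e k * u k j) * u N j) + u N j ^+ 2)); last first.
  move=> j _; rewrite big_ord_recr /= ltnn (eq_bigr (fun k : 'I_N => e k * u k j)).
    have -> : u N j ^+ 2 = (s * s) * u N j ^+ 2 by rewrite is_sign_sqr // mul1r.
    by ring.
  by move=> k _; rewrite ltn_ord.
rewrite !big_split /= -mulr_sumr -/T; lra.
Qed.

(** Each new sign vector is chosen greedily against the earlier ones. The sum of squared inner
    products is then at most [n] times the sum of [lam k ^+ 2], and small weights make this
    small. *)
Lemma almost_orthogonal_signs N n lam (rho : R) : 0 <= rho -> (forall k, 0 <= lam k) ->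
  (forall k, (k < N)%N -> lam k <= rho) -> \sum_(k < N) lam k <= 1 ->
  exists r : nat -> nat -> R, (forall i k, is_sign (r i k)) /\
    forall i j, (i < n)%N -> (j < n)%N -> i <> j ->
      (\sum_(k < N) lam k * (r i k * r j k)) ^+ 2 <= n%:R * rho.
Proof.
move=> rho0 l0 lr l1.
suff [r [rs hr]] : exists r : nat -> nat -> R, (forall i k, is_sign (r i k)) /\
    forall i j, (i < n)%N -> (j < i)%N ->
      (\sum_(k < N) lam k * (r i k * r j k)) ^+ 2 <= n%:R * rho.
  exists r; split=> // i j ilt jlt /eqP; rewrite neq_ltn => /orP[ij|ji]; last exact: hr.
  by under eq_bigr do rewrite [r i _ * _]mulrC; exact: hr.
elim: n => [|n [r [rs hr]]].
  by exists (fun _ _ => 1); split=> // i k; left.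
have [e [es he]] := greedy_signs N n (fun k j => lam k * r j k).
exists (fun i => if (i < n)%N then r i else e); split=> [i k|i j].
  by case: ifP => _; [exact: rs|exact: es].
have mono : n%:R * rho <= n.+1%:R * rho by rewrite ler_wpM2r // ler_nat.
rewrite ltnS leq_eqVlt => /predU1P[-> jn|iln ji]; last first.
  by rewrite iln (ltn_trans ji iln); apply: le_trans mono; exact: hr.
rewrite ltnn jn; apply: le_trans mono; apply: le_trans (_ : _ <= \sum_(j < n) (\sum_(k < N) e k * (lam k * r j k)) ^+ 2) _.
  rewrite (bigD1 (Ordinal jn)) //= -[X in X <= _]addr0; apply: lerD.
    by rewrite le_eqVlt; apply/orP; left; apply/eqP; congr (_ ^+ 2); apply: eq_bigr => k _; ring.
  by apply: sumr_ge0 => *; exact: sqr_ge0.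
apply: le_trans he _.
apply: (@le_trans _ _ (\sum_(k < N) n%:R * rho * lam k)); last first.
  by rewrite -mulr_sumr -[X in _ <= X]mulr1 ler_wpM2l // mulr_ge0.
apply: ler_sum => k _.
rewrite (eq_bigr (fun=> lam k * lam k)) => [|j0 _]; last first.
  by rewrite expr2 mulrACA (is_sign_sqr (rs j0 k)) mulr1.
rewrite sumr_const card_ord -[_ *+ n]mulr_natl -mulrA ler_wpM2l // ler_wpM2r //.
exact: lr.
Qed.

Section Bessel.
Variables (N n : nat) (lam : nat -> R) (r : nat -> nat -> R) (eta : R).
Hypotheses (lam0 : forall k, 0 <= lam k) (lam1 : \sum_(k < N) lam k <= 1).
Hypotheses (rs : forall i k, is_sign (r i k)) (eta0 : 0 <= eta) (neta : n%:R * eta <= 1).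
Hypothesis ortho : forall i j, (i < n)%N -> (j < n)%N -> i <> j ->
  `|\sum_(k < N) lam k * (r i k * r j k)| <= eta.

(** The Gram form is at most [1 + n * eta <= 2] times the sum of squares. Expanding the nonnegative
    weighted square of [d - s / 2] then bounds the sum of squared coefficients. *)
Lemma bessel d : \sum_(i < n) (\sum_(k < N) lam k * d k * r i k) ^+ 2 <=
  2 * \sum_(k < N) lam k * d k ^+ 2.
Proof.
pose b i := \sum_(k < N) lam k * d k * r i k.
pose s k := \sum_(i < n) b i * r i k.
pose B := \sum_(i < n) b i ^+ 2.
pose gr i j := \sum_(k < N) lam k * (r i k * r j k).
have e1 : \sum_(k < N) lam k * d k * s k = B.
  under eq_bigr do rewrite mulr_sumr.
  rewrite exchange_big /=; apply: eq_bigr => i _.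
  rewrite expr2 [X in _ = _ * X]/b mulr_sumr; apply: eq_bigr => k _; ring.
have e2 : \sum_(k < N) lam k * s k ^+ 2 = \sum_(i < n) \sum_(j < n) b i * b j * gr i j.
  transitivity (\sum_(k < N) \sum_(i < n) \sum_(j < n) b i * b j * (lam k * (r i k * r j k))).
    apply: eq_bigr => k _; rewrite expr2 /s big_distrlr /= mulr_sumr.
    apply: eq_bigr => i _; rewrite mulr_sumr; apply: eq_bigr => j _; ring.
  rewrite exchange_big /=; apply: eq_bigr => i _.
  rewrite exchange_big /=; apply: eq_bigr => j _.
  by rewrite -mulr_sumr.
have Q : \sum_(i < n) \sum_(j < n) b i * b j * gr i j <= 2 * B.
  apply: (@le_trans _ _ (\sum_(i < n) \sum_(j < n)
     ((i == j)%:R * b i ^+ 2 + eta * ((b i ^+ 2 + b j ^+ 2) / 2)))).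
    apply: ler_sum => i _; apply: ler_sum => j _.
    have sq : `|b i * b j| <= (b i ^+ 2 + b j ^+ 2) / 2.
      have := sqr_ge0 (b i - b j); have := sqr_ge0 (b i + b j).
      rewrite ler_norml !expr2; move=> *; apply/andP; split; lra.
    have [->|ij] := eqVneq i j.
      have gjj : gr j j <= 1.
        apply: le_trans lam1; apply: ler_sum => k _.
        by rewrite is_sign_sqr // mulr1.
      have b0 : 0 <= b j * b j by rewrite -expr2 sqr_ge0.
      have h1 := ler_wpM2l b0 gjj; have h2 := mulr_ge0 eta0 b0.
      by rewrite /= !expr2; lra.
    rewrite mul0r add0r; apply: le_trans (ler_norm _) _; rewrite normrM mulrC.
    apply: ler_pM => //; apply: ortho => // /val_inj /eqP; exact/negP.
  have -> : \sum_(i < n) \sum_(j < n) ((i == j)%:R * b i ^+ 2 +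
      eta * ((b i ^+ 2 + b j ^+ 2) / 2)) = B + eta * (n%:R * B).
    rewrite (eq_bigr (fun i : 'I_n => b i ^+ 2 + (eta / 2 * (n%:R * b i ^+ 2) + eta / 2 * B))).
      rewrite big_split /= big_split /= -!mulr_sumr -/B sumr_const card_ord.
      by rewrite -[_ *+ n]mulr_natl; field.
    move=> i _; rewrite big_split /=; congr (_ + _).
      rewrite (bigD1 i) //= eqxx mul1r big1 ?addr0 // => j ji.
      by rewrite eq_sym (negbTE ji) mul0r.
    rewrite (eq_bigr (fun j : 'I_n => eta / 2 * b i ^+ 2 + eta / 2 * b j ^+ 2)); last by move=> j _; field.
    rewrite big_split /= sumr_const card_ord -[_ *+ n]mulr_natl -mulr_sumr -/B; ring.
  have B0 : 0 <= B by apply: sumr_ge0 => *; exact: sqr_ge0.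
  by have := ler_wpM2r B0 neta; lra.
have : 0 <= \sum_(k < N) lam k * (d k - s k / 2) ^+ 2.
  by apply: sumr_ge0 => k _; rewrite mulr_ge0 // sqr_ge0.
rewrite (eq_bigr (fun k : 'I_N => lam k * d k ^+ 2 - lam k * d k * s k +
   4^-1 * (lam k * s k ^+ 2))); last by move=> k _; field.
rewrite big_split /= sumrB -mulr_sumr e1 e2 -/B; lra.
Qed.

Lemma coef_bound d i : `|\sum_(k < N) lam k * d k * r i k| <= \sum_(k < N) lam k * `|d k|.
Proof.
apply: le_trans (ler_norm_sum _ _ _) _; apply: ler_sum => k _.
by rewrite !normrM (is_sign_norm (rs i k)) mulr1 ger0_norm.
Qed.

End Bessel.
End Signs.

(** * Operators with small norm and large modulus *)

Section Blocks.
Variables (R : realType) (X : completeNormedModType R).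
Variables (le : X -> X -> Prop) (join : X -> X -> X).
Hypothesis H : is_banach_lattice le join.
Local Notation labs := (labs join).
Local Notation njoin := (njoin join).
Implicit Types (w x : nat -> X) (a c d : nat -> R) (q : R).

Let lexx' := blle_refl H.
Hint Resolve lexx' : core.

(** The negation is a lower [q]-estimate for [w]. *)
Definition lqfail q w := forall C : R, exists N c,
  `|\sum_(k < N) c k *: w k| <= 1 /\ C < \sum_(k < N) `|c k| `^ q.

(** Here [x k] is the image of [w k] under a contraction of a finite block whose moduli are
    large. *)
Definition block_gain w := forall Q : R, exists N x a,
  (forall c, `|\sum_(k < N) c k *: x k| <= `|\sum_(k < N) c k *: w k|) /\
  Q * `|\sum_(k < N) a k *: w k| < `|\sum_(k < N) labs (a k *: x k)|.

Lemma dominated_unit N x w :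
  (forall c, `|\sum_(k < N) c k *: w k| <= 1 -> `|\sum_(k < N) c k *: x k| <= 1) ->
  forall c, `|\sum_(k < N) c k *: x k| <= `|\sum_(k < N) c k *: w k|.
Proof.
move=> h c; set A := `|\sum_(k < N) c k *: w k|; apply/ler_addgt0Pr => e e0.
have A0 : 0 <= A by exact: normr_ge0.
have Ae : 0 < A + e by lra.
have sc (v : nat -> X) : `|\sum_(k < N) ((A + e)^-1 * c k) *: v k| =
    (A + e)^-1 * `|\sum_(k < N) c k *: v k|.
  rewrite -[X in X * _]gtr0_norm ?invr_gt0 // -normrZ scaler_sumr.
  by congr `|_|; apply: eq_bigr => k _; rewrite scalerA.
have := h (fun k => (A + e)^-1 * c k).
rewrite !sc -/A ![_^-1 * _]mulrC !ler_pdivrMr // !mul1r; apply; lra.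
Qed.

Section Disj.
Variable w : nat -> X.
Hypotheses (wd : disjseq le join w) (w1 : forall k, `|w k| = 1).

Lemma disj_coef_le N c k : (k < N)%N -> `|c k| <= `|\sum_(j < N) c j *: w j|.
Proof.
move=> kN; rewrite -[X in X <= _]mulr1 -(w1 k) -normrZ.
apply: (norm_labs_le H); rewrite (labs_sum_disj H) // (labs_scale H).
have w0 j : le 0 (w j) by case: wd.
rewrite (ge0_labs H) //.
apply: (sum_blle_term H (F := fun j : 'I_N => `|c j| *: w j) (j := Ordinal kN)) => // j _.
exact: (scale_blge0 H).
Qed.

Lemma disj_norm_abs N c : `|\sum_(k < N) `|c k| *: w k| = `|\sum_(k < N) c k *: w k|.
Proof.
have h k : (k < N)%N -> `| `|c k| | = `|c k| by rewrite normr_id.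
apply/eqP; rewrite eq_le; apply/andP; split.
  by apply: (disj_norm_le H (c := fun k => `|c k|) (d := c) wd) => k /h ->.
by apply: (disj_norm_le H (c := c) (d := fun k => `|c k|) wd) => k /h ->.
Qed.

(** On a block of length [N] the supremum is at most [N], as all coefficients are at most one. A
    vector attaining half of it is a sufficient substitute for a maximizer. *)
Lemma lq_extremal q B : 0 < q -> lqfail q w -> exists N a,
  [/\ forall k, 0 <= a k, `|\sum_(k < N) a k *: w k| <= 1,
      B <= \sum_(k < N) a k `^ q
    & forall c, `|\sum_(k < N) c k *: w k| <= 1 ->
        \sum_(k < N) `|c k| `^ q <= 2 * \sum_(k < N) a k `^ q].
Proof.
move=> q0 /(_ (2 * `|B| + 1))[N [c0 [c01 c0B]]].
pose S := [set v | exists2 c : nat -> R, `|\sum_(k < N) c k *: w k| <= 1 &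
  v = \sum_(k < N) `|c k| `^ q].
have Sub : ubound S N%:R.
  move=> _ [c c1 ->]; rewrite -[X in X%:R]card_ord -sumr_const.
  apply: ler_sum => k _; have := le_trans (disj_coef_le c (ltn_ord k)) c1 => ck.
  have <- : 1 `^ q = 1 :> R by rewrite powR1.
  by apply: ge0_ler_powR; rewrite ?nnegrE // ltW.
have S0 : S (\sum_(k < N) `|c0 k| `^ q) by exists c0.
have sB : 2 * `|B| + 1 < sup S.
  by apply: lt_le_trans c0B _; apply: ub_le_sup S0; exists N%:R.
have s0 : 0 < sup S by have := normr_ge0 B; lra.
have [_ [a a1 ->] ha] : exists2 v, S v & sup S / 2 < v.
  have := @sup_adherent _ S (sup S / 2) ltac:(lra) (conj (ex_intro _ _ S0) (ex_intro _ _ Sub)).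
  by move=> [v Sv hv]; exists v => //; lra.
exists N, (fun k => `|a k|); split=> //.
- by rewrite disj_norm_abs.
- have := ler_norm B; lra.
- move=> c c1; apply: (@le_trans _ _ (sup S)); last lra.
  by apply: ub_le_sup; [exists N%:R|exists c].
Qed.

(* [|b_i| <= e + b_i ^ 2 / e] trades the l2-bound on [b'] against [M = |F|]. *)
Lemma comb_bound n (b b' : nat -> R) (g : nat -> X) (F : X) (e beta B : R) :
  0 < e -> (forall i, (i < n)%N -> le 0 (g i) /\ `|g i| <= 2) ->
  le (\sum_(i < n) g i) F -> (forall i, `|b i| <= `|b' i| + beta) -> 0 <= beta ->
  \sum_(i < n) b' i ^+ 2 <= B ->
  `|\sum_(i < n) b i *: g i| <= (e + beta) * `|F| + 2 * B / e.
Proof.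
move=> e0 hg gF hb beta0 hB.
have F0 : le 0 F.
  by apply: (blle_trans H) gF; apply: (sum_blge0 H) => i _; case: (hg i (ltn_ord i)).
apply: (@le_trans _ _ `|(e + beta) *: F + e^-1 *: \sum_(i < n) (b' i ^+ 2) *: g i|).
  apply: (norm_blle H); apply: (blle_trans H) (labs_sum H _ _ _) _.
  apply: (@blle_trans _ _ _ _ H (\sum_(i < n) ((e + beta) *: g i + e^-1 *: (b' i ^+ 2 *: g i)))).
    apply: (sum_blle H) => i _; have [gi0 _] := hg i (ltn_ord i).
    rewrite (labs_scale H) (ge0_labs H) // scalerA -scalerDl.
    apply: (scale_blle H) => //; apply: le_trans (hb i) _.
    rewrite addrAC lerD2r -(ler_pM2l e0) mulrDr mulrA mulfV ?gt_eqF // mul1r.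
    have := sqr_ge0 (`|b' i| - e / 2); have := sqr_ge0 e.
    by rewrite -(real_normK (num_real (b' i))) !expr2; lra.
  rewrite big_split /= -!scaler_sumr; apply: (blle_add H) => //.
  by apply: (blle_scale H) => //; lra.
apply: le_trans (ler_normD _ _) _; apply: lerD.
  by rewrite normrZ gtr0_norm //; lra.
rewrite normrZ gtr0_norm ?invr_gt0 // mulrC ler_pM2r ?invr_gt0 //.
apply: le_trans (ler_norm_sum _ _ _) _; apply: (@le_trans _ _ (2 * \sum_(i < n) b' i ^+ 2)).
  rewrite mulr_sumr; apply: ler_sum => i _; rewrite normrZ ger0_norm ?sqr_ge0 // mulrC.
  by rewrite ler_wpM2r ?sqr_ge0 //; case: (hg i (ltn_ord i)).
by rewrite ler_pM2l.
Qed.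

End Disj.
End Blocks.

(** * Blocks from an unbounded sum of powers *)

Section PowerBlock.
Variables (R : realType) (X : completeNormedModType R).
Variables (le : X -> X -> Prop) (join : X -> X -> X).
Hypothesis H : is_banach_lattice le join.
Local Notation labs := (labs join).
Local Notation njoin := (njoin join).
Implicit Types (w x : nat -> X) (a c d : nat -> R) (q : R).

Let lexx' := blle_refl H.
Hint Resolve lexx' : core.

(** Averaging the signed sums against the sign vector [r j] isolates [g j] up to cross terms, which
    almost orthogonality bounds by [eta *: F]. The average of the moduli dominates each such
    average. *)
Lemma sup_le_average N n (lam : nat -> R) (r : nat -> nat -> R) (g : nat -> X) (F : X) (eta : R) :
  (forall k, 0 <= lam k) -> \sum_(k < N) lam k = 1 -> (forall i k, is_sign (r i k)) ->
  0 <= eta ->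
  (forall i j, (i < n)%N -> (j < n)%N -> i <> j ->
     `|\sum_(k < N) lam k * (r i k * r j k)| <= eta) ->
  (forall i, (i < n)%N -> le 0 (g i)) -> le (\sum_(i < n) g i) F ->
  let y := \sum_(k < N) lam k *: labs (\sum_(i < n) r i k *: g i) in
  le (njoin g n) (y + eta *: F).
Proof.
move=> l0 l1 rs eta0 ort g0 gF y.
have F0 : le 0 F.
  by apply: (blle_trans H) gF; apply: (sum_blge0 H) => i _; apply: g0.
have y0 : le 0 y.
  by apply: (sum_blge0 H) => k _; apply: (scale_blge0 H) => //; exact: (labs_ge0 H).
apply: (njoin_lub H).
  by rewrite -[0]addr0; apply: (blle_add H) => //; exact: (scale_blge0 H).
move=> j jn; pose gam i := \sum_(k < N) lam k * (r i k * r j k).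
have e1 : \sum_(i < n) gam i *: g i = \sum_(k < N) lam k *: (r j k *: \sum_(i < n) r i k *: g i).
  under eq_bigr do rewrite scaler_suml.
  rewrite exchange_big /=; apply: eq_bigr => k _.
  rewrite scalerA scaler_sumr; apply: eq_bigr => i _; rewrite scalerA; congr (_ *: _); ring.
have h1 : le (\sum_(i < n) gam i *: g i) y.
  rewrite e1; apply: (sum_blle H) => k _; apply: (blle_scale H) => //.
  apply: (blle_trans H) (labs_ge H _) _; rewrite (labs_scale H) (is_sign_norm (rs j k)).
  by rewrite scale1r.
have e2 : g j = \sum_(i < n) gam i *: g i - \sum_(i < n | i != Ordinal jn) gam i *: g i.
  rewrite [X in X - _](bigD1 (Ordinal jn)) //= addrK (_ : gam j = 1) ?scale1r //.
  by rewrite -l1; apply: eq_bigr => k _; rewrite is_sign_sqr // mulr1.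
rewrite e2; apply: (blle_add H) => //.
apply: (@blle_trans _ _ _ _ H (eta *: \sum_(i < n) g i)); last exact: (blle_scale H).
rewrite -sumrN scaler_sumr big_mkcond; apply: (sum_blle H) => i _.
case: ifP => [ij|_]; last by apply: (scale_blge0 H) => //; apply: g0.
rewrite -scaleNr; apply: (scale_blle H); first exact: g0.
have nij : nat_of_ord i <> j by move=> E; case/eqP: ij; exact: val_inj.
by have := ort i j (ltn_ord i) jn nij; rewrite -/(gam i) ler_norml => /andP[]; lra.
Qed.

Variable w : nat -> X.
Hypotheses (wd : disjseq le join w) (w1 : forall k, `|w k| = 1).

(** With [d = c / a], large values of [d] are small in the weighted l1-norm by extremality of [a],
    and bounded ones have small sign coefficients by Bessel. Signed sums are thus of order [e * M],
    while the average modulus keeps norm [M / 4]. *)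
Lemma block_gain_lq q : 1 < q -> lqfail q w ->
  (forall C, ~ joins_bounded le join C) -> block_gain join w.
Proof.
move=> q1 fail unb Q.
pose Q1 : R := `|Q| + 1; have Q10 : 1 <= Q1 by rewrite /Q1 lerDr.
pose e : R := (24 * Q1)^-1.
have e0 : 0 < e by rewrite invr_gt0; lra.
(* This is the truncation level for [d]: above it a number is at most [e / 4] times its [q]-th
   power. *)
pose s : R := (4 / e) `^ ((q - 1)^-1).
have s0 : 0 <= s by exact: powR_ge0.
have sq : s `^ (q - 1) = 4 / e.
  rewrite -powRrM mulVf ?subr_eq0 ?gt_eqF // powRr1 // divr_ge0 //; exact: ltW.
have [n [f [hf hM]]] : exists n f, (forall i, (i < n)%N -> le 0 (f i) /\ `|f i| <= 1) /\
    4 * s ^+ 2 / e ^+ 2 + 1 < `|njoin f n|.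
  apply: contrapT => no; apply: (unb (4 * s ^+ 2 / e ^+ 2 + 1)) => n f hf.
  by rewrite leNgt; apply/negP => h; apply: no; exists n, f.
have [g [hg gF FG]] := disjointify H hf.
set F := njoin f n in hM gF FG; set M := `|F|.
have M0 : 4 * s ^+ 2 / e <= e * M.
  rewrite ler_pdivrMr // mulrAC -expr2 -ler_pdivrMl ?exprn_gt0 //.
  by rewrite mulrC; apply: le_trans (ltW hM); rewrite lerDl.
have M1 : 1 <= M.
  have : 0 <= 4 * s ^+ 2 / e ^+ 2 by apply: divr_ge0; [apply: mulr_ge0|]; rewrite ?sqr_ge0.
  by move=> h; apply: le_trans (ltW hM); rewrite lerDr.
have n0 : (0 < n)%N.
  rewrite lt0n; apply/negP => /eqP n0; move: M1; rewrite /M /F n0 /= normr0.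
  by rewrite ler10.
have n0' : 0 < n%:R :> R by rewrite ltr0n.
(* This value satisfies the Bessel condition and keeps the error [eta *: F] below [M / 4]; [rho] is
   then set so that [n * rho = eta ^+ 2]. *)
pose eta : R := (4 * n%:R)^-1.
have eta0 : 0 < eta by rewrite invr_gt0 mulr_gt0.
have neta : n%:R * eta <= 4^-1 by rewrite /eta invfM mulrCA mulfV ?mulr1 // gt_eqF.
pose rho : R := eta ^+ 2 / n%:R.
have rho0 : 0 < rho by rewrite divr_gt0 // exprn_gt0.
have [N [a [a0 a1 aA aext]]] := lq_extremal H wd w1 (rho^-1) (lt_trans ltr01 q1) fail.
set A := \sum_(k < N) a k `^ q in aA aext.
have A0 : 0 < A by apply: lt_le_trans aA; rewrite invr_gt0.
pose lam k := a k `^ q / A.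
have lam0 k : 0 <= lam k by rewrite divr_ge0 ?powR_ge0 // ltW.
have lam1 : \sum_(k < N) lam k = 1 by rewrite -mulr_suml -/A mulfV // gt_eqF.
have q0 : 0 < q by exact: lt_trans ltr01 q1.
have lamr k : (k < N)%N -> lam k <= rho.
  move=> kN; apply: (@le_trans _ _ (1 / A)).
    rewrite ler_pM2r ?invr_gt0 // -[X in _ <= X](_ : 1 `^ q = 1); last by rewrite powR1.
    apply: ge0_ler_powR; rewrite ?nnegrE //; first exact: ltW.
    by apply: le_trans a1; rewrite -[X in X <= _]ger0_norm //; exact: (disj_coef_le H wd w1).
  by rewrite div1r -[rho]invrK lef_pV2 // posrE invr_gt0.
have [r [rs hr]] := almost_orthogonal_signs n (ltW rho0) lam0 lamr
  (eq_ind_r (fun v => v <= 1) (lexx 1) lam1).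
have ort i j : (i < n)%N -> (j < n)%N -> i <> j ->
    `|\sum_(k < N) lam k * (r i k * r j k)| <= eta.
  move=> ilt jlt ij; have := hr i j ilt jlt ij.
  rewrite /rho mulrCA mulfV ?gt_eqF // mulr1 -real_normK ?num_real // ler_sqr ?nnegrE //.
  exact: ltW.
pose u k := \sum_(i < n) r i k *: g i.
(* The factor normalizes the block operator to a contraction. *)
pose sig : R := (3 * e * M * A)^-1.
have sig0 : 0 < sig by rewrite invr_gt0 !mulr_gt0 //; exact: lt_le_trans ltr01 M1.
pose x k := (sig * a k `^ (q - 1)) *: u k.
exists N, x, a; split.
  apply: dominated_unit => c c1.
  (* Where [a k] vanishes the quotient is [0], which loses nothing because [x k] vanishes there
     too. *)
  pose d k := c k / a k.
  pose d1 k := if `|d k| <= s then d k else 0.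
  pose d2 k := if `|d k| <= s then 0 else d k.
  pose b i := \sum_(k < N) lam k * d k * r i k.
  pose b1 i := \sum_(k < N) lam k * d1 k * r i k.
  have -> : \sum_(k < N) c k *: x k = (sig * A) *: \sum_(i < n) b i *: g i.
    rewrite scaler_sumr; under [RHS]eq_bigr do rewrite scalerA mulr_sumr scaler_suml.
    rewrite exchange_big /=; apply: eq_bigr => k _.
    rewrite /x /u scalerA scaler_sumr; apply: eq_bigr => i _.
    rewrite scalerA; congr (_ *: _).
    have -> : c k * (sig * a k `^ (q - 1)) * r i k = sig * (a k `^ (q - 1) * c k) * r i k by ring.
    have -> : a k `^ (q - 1) * c k = A * (lam k * d k).
      rewrite /lam /d mulrA [A * _]mulrC divfK ?gt_eqF // -(mulr_powRB1 (a0 k) q0).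
      have [->|ak] := eqVneq (a k) 0; last by field.
      by rewrite powR0 ?mul0r // subr_eq0 gt_eqF.
    by ring.
  have hd2 : \sum_(k < N) lam k * `|d2 k| <= e / 2.
    apply: (@le_trans _ _ (\sum_(k < N) e / 4 / A * `|c k| `^ q)).
      apply: ler_sum => k _; rewrite /d2; case: ifP => [_|/negbT].
        by rewrite normr0 mulr0 mulr_ge0 ?powR_ge0 // !divr_ge0 //; exact: ltW.
      rewrite -ltNge => sd.
      have dq : `|d k| <= e / 4 * `|d k| `^ q.
        rewrite -(mulr_powRB1 (normr_ge0 _) q0) mulrCA ler_peMr //.
        have : s `^ (q - 1) <= `|d k| `^ (q - 1).
          by apply: ge0_ler_powR; rewrite ?nnegrE ?subr_ge0 ?(ltW q1) // ltW.
        rewrite sq => h; rewrite -(ler_pM2l (_ : 0 < 4 / e)); last by rewrite divr_gt0.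
        rewrite mulr1 mulrA (_ : 4 / e * (e / 4) = 1) ?mul1r //.
        by field; rewrite gt_eqF.
      have lq : lam k * `|d k| `^ q <= A^-1 * `|c k| `^ q.
        rewrite /lam /d [_ / A]mulrC -mulrA ler_pM2l ?invr_gt0 //.
        rewrite -powRM // normrM [`|(a k)^-1|]normfV (ger0_norm (a0 k)).
        apply: ge0_ler_powR; rewrite ?nnegrE //; [exact: ltW|by rewrite !mulr_ge0 // invr_ge0|].
        have [->|ak] := eqVneq (a k) 0; first by rewrite mul0r.
        by rewrite mulrCA mulfV // mulr1.
      apply: le_trans (ler_wpM2l (lam0 k) dq) _.
      by rewrite mulrCA -[X in _ <= X]mulrA ler_pM2l // divr_gt0.
    rewrite -mulr_sumr; have := aext c c1 => h.
    apply: (@le_trans _ _ (e / 4 / A * (2 * A))).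
      by rewrite ler_pM2l // !divr_gt0.
    by rewrite le_eqVlt; apply/orP; left; apply/eqP; field; rewrite gt_eqF.
  have hb i : `|b i| <= `|b1 i| + e / 2.
    have -> : b i = b1 i + \sum_(k < N) lam k * d2 k * r i k.
      rewrite /b /b1 -big_split /=; apply: eq_bigr => k _.
      by rewrite /d1 /d2; case: ifP => _; ring.
    apply: le_trans (ler_normD _ _) _; rewrite lerD2l; apply: le_trans hd2.
    exact: coef_bound.
  have hB : \sum_(i < n) b1 i ^+ 2 <= 2 * s ^+ 2.
    apply: le_trans (bessel (eta := eta) lam0 _ rs (ltW eta0) _ ort d1) _.
    - by rewrite lam1.
    - by apply: le_trans neta _; lra.
    rewrite ler_pM2l // -[X in _ <= X]mul1r -lam1 mulr_suml; apply: ler_sum => k _.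
    rewrite ler_wpM2l // /d1; case: ifP => [ds|_]; last by rewrite expr0n sqr_ge0.
    by rewrite -real_normK ?num_real // ler_sqr ?nnegrE.
  have e20 : 0 <= e / 2 by lra.
  (* The bound is [(e + e / 2) * M + 4 * s ^+ 2 / e], at most [5 / 2 * (e * M)] and so below the
     [3 * e * M] built into [sig]. *)
  have := comb_bound H e0 hg gF hb e20 hB; rewrite -/M => h.
  rewrite normrZ gtr0_norm ?mulr_gt0 //.
  have -> : sig * A = (3 * e * M)^-1.
    by rewrite /sig invfM divfK // gt_eqF.
  rewrite mulrC ler_pdivrMr ?mulr_gt0 ?mul1r //; last exact: lt_le_trans ltr01 M1.
  apply: le_trans h _.
  have eM : 0 <= e * M by exact: mulr_ge0 (ltW e0) (normr_ge0 F).
  rewrite (_ : 2 * (2 * s ^+ 2) / e = 4 * s ^+ 2 / e); last by rewrite mulrA -natrM.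
  by clear -M0 eM; move: (4 * s ^+ 2 / e) M0 => z; lra.
pose y := \sum_(k < N) lam k *: labs (u k).
have -> : \sum_(k < N) labs (a k *: x k) = (sig * A) *: y.
  rewrite /y scaler_sumr; apply: eq_bigr => k _.
  rewrite /x scalerA (labs_scale H) scalerA; congr (_ *: _).
  rewrite ger0_norm; last by rewrite !mulr_ge0 ?powR_ge0 // ltW.
  rewrite mulrCA mulr_powRB1 // /lam; field; by rewrite gt_eqF.
have hG := sup_le_average lam0 lam1 rs (ltW eta0) ort (fun i h => proj1 (hg i h)) gF.
have hy : M / 4 <= `|y|.
  have : `|njoin g n| <= `|y + eta *: F|.
    by apply: (norm_blge0 H) => //; exact: (njoin_ge0 H).
  move=> /le_trans -/(_ _ (ler_normD _ _)); rewrite normrZ gtr0_norm // -/M.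
  have : eta * M <= 4^-1 * M.
    apply: ler_wpM2r; first exact: normr_ge0.
    apply: le_trans neta; rewrite ler_peMl ?ler1n //; exact: ltW.
  move: FG; rewrite -/M; lra.
rewrite normrZ gtr0_norm ?mulr_gt0 //.
have -> : sig * A = (3 * e * M)^-1.
  by rewrite /sig invfM divfK // gt_eqF.
(* Dividing [M / 4] by [3 * e * M] leaves [1 / (12 * e)], which is [2 * Q1] by the choice of [e]. *)
apply: (@lt_le_trans _ _ (2 * Q1)); last first.
  rewrite [X in _ <= X]mulrC ler_pdivlMr; last by rewrite !mulr_gt0 //; exact: lt_le_trans ltr01 M1.
  apply: le_trans hy; rewrite /e.
  by rewrite le_eqVlt; apply/orP; left; apply/eqP; field; rewrite gt_eqF //; lra.
apply: (@le_lt_trans _ _ (`|Q| * 1)).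
  apply: (@le_trans _ _ (`|Q| * `|\sum_(k < N) a k *: w k|)); last exact: ler_wpM2l.
  by rewrite ler_wpM2r // ler_norm.
by rewrite /Q1; have := normr_ge0 Q; lra.
Qed.

End PowerBlock.

(** * Gluing blocks *)

Section Glue.
Variables (R : realType) (X : completeNormedModType R).
Variables (le : X -> X -> Prop) (join : X -> X -> X).
Hypothesis H : is_banach_lattice le join.
Local Notation labs := (labs join).
Implicit Types (x z : nat -> X) (a c d : nat -> R).

Let lexx' := blle_refl H.
Hint Resolve lexx' : core.

Definition shift K (w : nat -> X) k := w (K + k)%N.

Lemma disj_shift K w : disjseq le join w -> disjseq le join (shift K w).
Proof.
by move=> [w0 wd]; split=> [k|j k jk]; [exact: w0|apply: wd => /addnI].
Qed.

Lemma sum_window (v : nat -> X) K N M : (K + N <= M)%N ->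
  \sum_(k < M) (if (K <= k < K + N)%N then v k else 0) = \sum_(j < N) v (K + j)%N.
Proof.
move=> KM; transitivity (\sum_(k < K + N) if (K <= k)%N then v k else 0).
  rewrite (big_ord_widen _ (fun k => if (K <= k)%N then v k else 0) KM) [RHS]big_mkcond.
  by apply: eq_bigr => k _; case: (K <= k)%N; case: (k < K + N)%N.
rewrite big_split_ord /= big1 ?add0r => [|k _]; last by rewrite leqNgt ltn_ord.
by apply: eq_bigr => j _; rewrite leq_addr.
Qed.

Lemma geometric_half m : \sum_(b < m) (2 ^+ b.+2)^-1 <= 2^-1 :> R.
Proof.
have -> : \sum_(b < m) (2 ^+ b.+2)^-1 = 2^-1 - (2 ^+ m.+1)^-1 :> R.
  elim: m => [|m IH]; first by rewrite big_ord0 expr1 subrr.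
  rewrite big_ord_recr /= IH (exprS 2 m.+1); field.
  by rewrite expf_neq0.
by rewrite gerBl invr_ge0 exprn_ge0.
Qed.

Lemma archi_nat (A : R) : exists b : nat, A <= b%:R.
Proof.
exists (Num.bound `|A|); apply: ltW; apply: le_lt_trans (ler_norm A) _.
exact: archi_boundP.
Qed.

Variable w : nat -> X.
Hypotheses (wd : disjseq le join w) (w1 : forall k, `|w k| = 1).

Lemma window_dominated K N x :
  (forall c, `|\sum_(k < N) c k *: x k| <= `|\sum_(k < N) c k *: shift K w k|) ->
  forall m c, `|\sum_(k < m) c k *: (if (K <= k < K + N)%N then x (k - K)%N else 0)| <=
    `|\sum_(k < m) c k *: w k|.
Proof.
move=> dom m c; pose M := maxn m (K + N).
have mM : (m <= M)%N by exact: leq_maxl.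
pose c' k := (k < m)%:R * c k.
have ext (v : nat -> X) : \sum_(k < m) c k *: v k = \sum_(k < M) c' k *: v k.
  by rewrite -(sum_restrict v c mM).
rewrite (ext w).
pose d k := if (K <= k < K + N)%N then c' k else 0.
apply: (@le_trans _ _ `|\sum_(k < M) d k *: w k|); last first.
  apply: (disj_norm_le H (c := d) (d := c') wd) => k _; rewrite /d; case: ifP => // _.
  by rewrite normr0.
have KM : (K + N <= M)%N by exact: leq_maxr.
have -> : \sum_(k < M) d k *: w k = \sum_(j < N) c' (K + j)%N *: shift K w j.
  rewrite -(sum_window (fun k => c' k *: w k) KM); apply: eq_bigr => k _.
  by rewrite /d; case: ifP => // _; rewrite scale0r.
have -> : \sum_(k < m) c k *: (if (K <= k < K + N)%N then x (k - K)%N else 0) =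
    \sum_(j < N) c' (K + j)%N *: x j.
  rewrite (ext (fun k => if (K <= k < K + N)%N then x (k - K)%N else 0)).
  transitivity (\sum_(j < N) c' (K + j)%N *: x (K + j - K)%N); last first.
    by apply: eq_bigr => j _; rewrite addKn.
  rewrite -(sum_window (fun k => c' k *: x (k - K)%N) KM); apply: eq_bigr => k _.
  by case: ifP => // _; rewrite scaler0.
exact: (dom (fun j => c' (K + j)%N)).
Qed.

(** Block contractions on disjoint windows are added with total weight at most one half, so [z]
    stays equivalent to [w]; in window [b] the gain still outgrows the weight. *)
Lemma glue_blocks : (forall K, block_gain join (shift K w)) ->
  exists z, unconditional_basic_seq z /\ ~ absolute_seq join z.
Proof.
move=> gain.
have w0 k : le 0 (w k) by case: wd.
(* The power of two cancels the weight [e b], leaving the unbounded factor [b + 3]. *)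
pose Q b : R := 2 ^+ b.+2 * b.+3%:R.
pose P (Kb : nat * nat) (t : nat * (nat -> X) * (nat -> R)) :=
  (forall c, `|\sum_(k < t.1.1) c k *: t.1.2 k| <= `|\sum_(k < t.1.1) c k *: shift Kb.1 w k|) /\
  Q Kb.2 * `|\sum_(k < t.1.1) t.2 k *: shift Kb.1 w k| < `|\sum_(k < t.1.1) labs (t.2 k *: t.1.2 k)|.
have exP Kb : exists t, P Kb t.
  by case: Kb => K b; have [N [x [a h]]] := gain K (Q b); exists (N, x, a).
have [f hf] := choice exP.
(* The extra successor ensures [b <= K b] even for empty blocks, so only windows with [b <= k] can
   contain [k]. *)
pose fix K b := if b is b'.+1 then (K b' + (f (K b', b')).1.1).+1 else 0%N.
pose N b := (f (K b, b)).1.1.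
have KS b : K b.+1 = (K b + N b).+1 by [].
have Kge b : (b <= K b)%N by elim: b => // b IH; rewrite KS; lia.
have Kmono b b' : (b < b')%N -> (K b + N b <= K b')%N.
  elim: b' => // b' IH; rewrite ltnS KS leq_eqVlt => /predU1P[->|/IH]; lia.
pose inw b k := (K b <= k < K b + N b)%N.
pose xb b k := if inw b k then (f (K b, b)).1.2 (k - K b)%N else 0.
pose ab b k := if inw b k then (f (K b, b)).2 (k - K b)%N else 0.
pose e b : R := (2 ^+ b.+2)^-1.
have e0 b : 0 < e b by rewrite invr_gt0 exprn_gt0.
have xdom b m c : `|\sum_(k < m) c k *: xb b k| <= `|\sum_(k < m) c k *: w k|.
  by apply: window_dominated; have [] := hf (K b, b).
pose z k := w k + \sum_(b < k.+1) e b *: xb b k.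
have zE B k : (k < B)%N -> z k = w k + \sum_(b < B) e b *: xb b k.
  move=> kB; congr (_ + _).
  rewrite (big_ord_widen _ (fun b => e b *: xb b k) kB) big_mkcond.
  apply: eq_bigr => b _; case: ltnP => // kb; rewrite /xb /inw.
  by rewrite leqNgt (leq_trans kb (Kge b)) scaler0.
have zsum m c : \sum_(k < m) c k *: z k = \sum_(k < m) c k *: w k +
    \sum_(b < m) e b *: \sum_(k < m) c k *: xb b k.
  have -> : \sum_(b < m) e b *: \sum_(k < m) c k *: xb b k =
      \sum_(k < m) c k *: \sum_(b < m) e b *: xb b k.
    under eq_bigr do rewrite scaler_sumr.
    rewrite exchange_big /=; apply: eq_bigr => k _; rewrite scaler_sumr.
    by apply: eq_bigr => b _; rewrite !scalerA mulrC.
  rewrite -big_split /=; apply: eq_bigr => k _; rewrite (zE m k) //.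
  by rewrite scalerDr.
have pert m c : `|\sum_(b < m) e b *: \sum_(k < m) c k *: xb b k| <=
    2^-1 * `|\sum_(k < m) c k *: w k|.
  apply: le_trans (ler_norm_sum _ _ _) _.
  apply: (@le_trans _ _ (\sum_(b < m) e b * `|\sum_(k < m) c k *: w k|)).
    by apply: ler_sum => b _; rewrite normrZ gtr0_norm // ler_pM2l.
  by rewrite -mulr_suml ler_wpM2r // geometric_half.
have zup m c : `|\sum_(k < m) c k *: z k| <= 3 / 2 * `|\sum_(k < m) c k *: w k|.
  by rewrite zsum; apply: le_trans (ler_normD _ _) _; have := pert m c; lra.
have zlow m c : 2^-1 * `|\sum_(k < m) c k *: w k| <= `|\sum_(k < m) c k *: z k|.
  rewrite zsum; set u := \sum_(k < m) _ *: w _; set v := \sum_(b < m) _.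
  have : `|u| <= `|u + v| + `|v|.
    by rewrite -[X in `|X| <= _](addrK v u); exact: ler_normB.
  by have := pert m c; rewrite -/u -/v; lra.
exists z; split.
  apply: (@unconditional_criterion _ _ z 3) => [k|m c th].
    pose dk j : R := (j == k)%:R.
    have h1 := zlow k.+1 dk; have h2 := disj_coef_le H wd w1 dk (ltnSn k).
    apply/eqP => zk; move: h1.
    have -> : \sum_(j < k.+1) dk j *: z j = 0.
      apply: big1 => j _; rewrite /dk; case: eqP => [->|_]; last by rewrite scale0r.
      by rewrite zk scaler0.
    by move: h2; rewrite normr0 /dk eqxx normr1; lra.
  have h1 : `|\sum_(k < m) ((th k)%:R * c k) *: w k| <= `|\sum_(k < m) c k *: w k|.
    apply: (disj_norm_le H (c := fun k => (th k)%:R * c k) (d := c) wd) => k _.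
    by case: (th k); rewrite ?mul1r // mul0r normr0.
  by have := zup m (fun k => (th k)%:R * c k); have := zlow m c; lra.
move=> [_ [A [A1 abs]]].
(* In window [b], absoluteness would give [(b + 3) * W < (3 / 2 * A + 1) * W], impossible for this
   [b]. *)
have [b hb] := archi_nat (3 / 2 * A).
pose m := (K b + N b)%N.
have az k : ab b k *: z k = ab b k *: w k + e b *: (ab b k *: xb b k).
  rewrite /ab; case: ifP => [ik|_]; last by rewrite !scale0r scaler0 addr0.
  have kb : (b < k.+1)%N by have := Kge b; move: ik; rewrite /inw; lia.
  rewrite scalerA mulrC -scalerA -scalerDr; congr (_ *: _).
  rewrite /z (bigD1 (Ordinal kb)) //= big1 ?addr0 // => b' bb'.
  rewrite /xb (_ : inw b' k = false) ?scaler0 //; apply/negbTE.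
  have nb : (nat_of_ord b' != b) by apply: contraNneq bb' => E; apply/eqP/val_inj.
  move: ik; rewrite /inw; move: nb; rewrite neq_ltn => /orP[/Kmono|/Kmono]; lia.
pose W := `|\sum_(k < m) ab b k *: w k|.
have W0 : 0 <= W by exact: normr_ge0.
have h1 := abs m (ab b); have h2 := zup m (ab b); rewrite -/W in h2.
have h3 : e b * `|\sum_(k < m) labs (ab b k *: xb b k)| <=
    `|\sum_(k < m) labs (ab b k *: z k)| + W.
  rewrite -[e b]gtr0_norm // -normrZ.
  have hW : W = `|\sum_(k < m) labs (ab b k *: w k)|.
    rewrite /W -[LHS](norm_labs H) (labs_sum_disj H m (ab b) wd); congr `|_|; apply: eq_bigr => k _.
    by rewrite (labs_scale H) (ge0_labs H).
  rewrite hW; apply: le_trans (ler_normD _ _); apply: (norm_blge0 H).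
    apply: (scale_blge0 H) (ltW (e0 b)) _.
    by apply: (sum_blge0 H) => k _; exact: (labs_ge0 H).
  rewrite scaler_sumr -big_split /=; apply: (sum_blle H) => k _.
  have -> : e b *: labs (ab b k *: xb b k) = labs (e b *: (ab b k *: xb b k)).
    by rewrite (labs_scale H (e b)) gtr0_norm.
  have -> : e b *: (ab b k *: xb b k) = ab b k *: z k - ab b k *: w k.
    by rewrite az addrC addKr.
  by apply: (blle_trans H) (labs_add H _ _) _; rewrite (labs_opp H).
have [_ ht] := hf (K b, b).
have eW : `|\sum_(k < N b) (f (K b, b)).2 k *: shift (K b) w k| = W.
  rewrite /W /m; congr `|_|.
  transitivity (\sum_(j < N b) (f (K b, b)).2 (K b + j - K b)%N *: w (K b + j)%N).
    by apply: eq_bigr => j _; rewrite addKn.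
  rewrite -(sum_window (fun k => (f (K b, b)).2 (k - K b)%N *: w k) (leqnn _)).
  by apply: eq_bigr => k _; rewrite /ab /inw; case: ifP => // _; rewrite scale0r.
have eX : \sum_(k < N b) labs ((f (K b, b)).2 k *: (f (K b, b)).1.2 k) =
    \sum_(k < m) labs (ab b k *: xb b k).
  transitivity (\sum_(j < N b) labs ((f (K b, b)).2 (K b + j - K b)%N *: (f (K b, b)).1.2 (K b + j - K b)%N)).
    by apply: eq_bigr => j _; rewrite addKn.
  rewrite -(sum_window (fun k => labs ((f (K b, b)).2 (k - K b)%N *: (f (K b, b)).1.2 (k - K b)%N)) (leqnn _)).
  apply: eq_bigr => k _; rewrite /ab /xb /inw; case: ifP => // _.
  by rewrite scale0r (ge0_labs H).
move: ht; rewrite /= -/(N b) eW eX => ht.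
have : b.+3%:R * W < e b * `|\sum_(k < m) labs (ab b k *: xb b k)|.
  rewrite -(ltr_pM2l (exprn_gt0 b.+2 (ltr0n R 2 : _ = true))).
  by rewrite mulrA [X in _ < X]mulrA mulfV ?mul1r // expf_neq0.
have -> : b.+3%:R = b%:R + 3 :> R by rewrite -[b.+3]addn3 natrD.
have h4 : A * `|\sum_(k < m) ab b k *: z k| <= A * (3 / 2 * W) by rewrite ler_wpM2l //; lra.
have h5 := ler_wpM2r W0 hb.
lra.
Qed.

End Glue.

(** * The l1 cases *)

Section L1Blocks.
Variables (R : realType) (X : completeNormedModType R).
Variables (le : X -> X -> Prop) (join : X -> X -> X).
Hypothesis H : is_banach_lattice le join.
Local Notation labs := (labs join).
Implicit Types (x z : nat -> X) (a c d : nat -> R).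

Let lexx' := blle_refl H.
Hint Resolve lexx' : core.

Lemma sum_grid (V : zmodType) (f : nat -> V) n L :
  \sum_(l < n * L) f l = \sum_(i < n) \sum_(k < L) f (i * L + k)%N.
Proof.
elim: n => [|n IH]; first by rewrite mul0n !big_ord0.
rewrite mulSnr big_split_ord /= IH [RHS]big_ord_recr /=.
by congr (_ + _); apply: eq_bigr => k _; rewrite ?addnC.
Qed.

(** This is nonnegativity of the variance of the moduli. *)
Lemma l1_l2_mean n (S : nat -> R) : (0 < n)%N ->
  (n%:R^-1 * \sum_(i < n) `|S i|) ^+ 2 <= n%:R^-1 * \sum_(i < n) S i ^+ 2.
Proof.
move=> n0; have n0' : 0 < n%:R :> R by rewrite ltr0n.
set mu := n%:R^-1 * _.
have : 0 <= \sum_(i < n) (`|S i| - mu) ^+ 2 by apply: sumr_ge0 => *; exact: sqr_ge0.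
have -> : \sum_(i < n) (`|S i| - mu) ^+ 2 = \sum_(i < n) S i ^+ 2 - n%:R * mu ^+ 2.
  rewrite (eq_bigr (fun i : 'I_n => S i ^+ 2 - 2 * mu * `|S i| + mu ^+ 2)); last first.
    by move=> i _; rewrite -[in RHS](real_normK (num_real (S i))); ring.
  rewrite big_split sumrB /= -mulr_sumr sumr_const card_ord -[_ *+ n]mulr_natl.
  have -> : \sum_(i < n) `|S i| = n%:R * mu by rewrite /mu mulrA mulfV ?mul1r // gt_eqF.
  by ring.
by rewrite subr_ge0 mulrC -ler_pdivlMr // mulrC.
Qed.

Lemma bernoulli_expr (t : R) j : 0 <= t -> 1 + j%:R * t <= (1 + t) ^+ j.
Proof.
move=> t0; elim: j => [|j IH]; first by rewrite mul0r addr0 expr0.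
have jt : 0 <= j%:R * t * t by rewrite !mulr_ge0.
rewrite exprS -natr1; have := ler_wpM2l (_ : 0 <= 1 + t) IH.
move=> /(_ ltac:(lra)); lra.
Qed.

(** These are the estimates of Rademacher functions in an l1 space: an upper 2-estimate for signed
    sums and a lower l1-estimate for sums of moduli. *)
Definition rademacher_block N x :=
  (forall c, `|\sum_(k < N) c k *: x k| ^+ 2 <= \sum_(k < N) c k ^+ 2) /\
  (forall a, 2^-1 * \sum_(k < N) `|a k| <= `|\sum_(k < N) labs (a k *: x k)|).

Variable w : nat -> X.
Hypotheses (wd : disjseq le join w) (w1 : forall k, `|w k| = 1).

(** If no such grid exists, iteration bounds the norm of any [n ^ j] consecutive vectors by
    [(n / 2) ^ j]. Constant coefficients then refute a lower [q]-estimate on every tail for a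
    suitable [q] close to one. *)
Lemma l1_grid n : (0 < n)%N ->
  (forall q : R, 1 < q -> q <= 2 -> exists K, ~ lqfail q (shift K w)) ->
  exists p L (s : R), [/\ 0 <= s,
    forall i, (i < n)%N -> s * `|\sum_(k < L) w (p + (i * L + k))%N| <= 1
  & n%:R / 2 <= s * `|\sum_(k < n * L) w (p + k)%N|].
Proof.
move=> n0 hq; apply: contrapT => no.
have n0' : 0 < n%:R :> R by rewrite ltr0n.
pose h : R := n%:R / 2; have h0 : 0 < h by rewrite divr_gt0.
have up j p : `|\sum_(k < n ^ j) w (p + k)%N| <= h ^+ j.
  elim: j p => [|j IH] p; first by rewrite big_ord1 w1 expr0.
  rewrite leNgt; apply/negP => lt; apply: no.
  exists p, (n ^ j)%N, (h ^+ j)^-1; split.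
  - by rewrite invr_ge0 exprn_ge0 // ltW.
  - move=> i _; rewrite mulrC ler_pdivrMr ?exprn_gt0 // mul1r.
    by under eq_bigr do rewrite addnA; exact: IH.
  - rewrite [X in _ <= X]mulrC ler_pdivlMr ?exprn_gt0 // -/h -exprS -expnS; exact: ltW.
(* For this exponent [h ^ q = h * h ^ (1 / n)], and [n / 2 < 2 ^ n] makes it less than [n], so the
   power sums grow geometrically in [j]. *)
pose q : R := 1 + n%:R^-1.
have q1 : 1 < q by rewrite ltrDl invr_gt0.
have q2 : q <= 2 by rewrite /q -[2]/(1 + 1) lerD2l invf_le1 // ler1n.
have [K nf] := hq q q1 q2.
have q0 : 0 < q by lra.
have hq' : h `^ q < n%:R.
  rewrite -(mulr_powRB1 (ltW h0) q0) (_ : q - 1 = n%:R^-1); last by rewrite /q; ring.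
  rewrite [X in _ < X](_ : n%:R = h * 2); last by rewrite /h divfK.
  rewrite ltr_pM2l //.
  have -> : 2 = (2 ^+ n) `^ (n%:R^-1) :> R.
    by rewrite -powR_mulrn // -powRrM mulfV ?powRr1 // gt_eqF.
  apply: gt0_ltr_powR; rewrite ?nnegrE ?invr_gt0 //; first exact: ltW.
  rewrite /h ltr_pdivrMr // -natrX -natrM ltr_nat.
  by apply: leq_trans (ltn_expl n (ltnSn 1)) _; rewrite leq_pmulr.
apply: nf => C.
pose tau := n%:R / h `^ q - 1.
have hq0 : 0 < h `^ q by exact: powR_gt0.
have tau0 : 0 < tau by rewrite subr_gt0 ltr_pdivlMr // mul1r.
have [j hj] := archi_nat (`|C| / tau).
exists (n ^ j)%N, (fun=> (h ^+ j)^-1); split.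
  rewrite -scaler_sumr normrZ gtr0_norm ?invr_gt0 ?exprn_gt0 // mulrC.
  by rewrite ler_pdivrMr ?exprn_gt0 // mul1r; exact: up.
rewrite sumr_const card_ord gtr0_norm ?invr_gt0 ?exprn_gt0 //.
have -> : (h ^+ j)^-1 `^ q *+ n ^ j = (1 + tau) ^+ j.
  have -> : 1 + tau = n%:R * (h `^ q)^-1 by rewrite /tau; ring.
  rewrite [RHS]exprMn -natrX -[_ *+ (n ^ j)]mulr_natl.
  congr (_ * _).
  have -> : (h ^+ j)^-1 = h `^ (- j%:R) by rewrite powR_invn // ltW.
  by rewrite -powRrM mulNr mulrC powRN powRrM powR_mulrn ?powR_ge0 // exprVn.
apply: lt_le_trans (bernoulli_expr j (ltW tau0)).
move: hj; rewrite ler_pdivrMr // => hj.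
by have := ler_norm C; lra.
Qed.

Lemma rademacher_block_exists N :
  (forall q : R, 1 < q -> q <= 2 -> exists K, ~ lqfail q (shift K w)) ->
  exists x, rademacher_block N x.
Proof.
move=> hq; have [r [rs rsq _]] := rademacher R N.
pose n := (2 ^ N)%N; have n0 : (0 < n)%N by rewrite expn_gt0.
have n0' : 0 < n%:R :> R by rewrite ltr0n.
have [p [L [s [s0 sle sge]]]] := l1_grid n0 hq.
have L0 : (0 < L)%N.
  rewrite lt0n; apply/negP => /eqP L0; move: sge; rewrite L0 muln0 big_ord0 normr0 mulr0.
  by rewrite leNgt divr_gt0.
(* The signs are constant on each of the [n] pieces of length [L], and every [x k] has the same
   modulus. *)
pose x k := (s / n%:R) *: \sum_(l < n * L) r k (l %/ L)%N *: w (p + l)%N.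
have pd := disj_shift p wd.
exists x; split=> [c|a].
  pose S i := \sum_(k < N) c k * r k i.
  have -> : \sum_(k < N) c k *: x k =
      n%:R^-1 *: \sum_(i < n) S i *: (s *: \sum_(k < L) w (p + (i * L + k))%N).
    transitivity ((s / n%:R) *: \sum_(l < n * L) S (l %/ L)%N *: w (p + l)%N).
      under [in RHS]eq_bigr do rewrite scaler_suml.
      rewrite exchange_big /= scaler_sumr; apply: eq_bigr => k _.
      rewrite /x scalerA [c k * _]mulrC -[LHS]scalerA; congr (_ *: _); rewrite scaler_sumr.
      by apply: eq_bigr => l _; rewrite scalerA.
    rewrite mulrC -[LHS]scalerA; congr (_ *: _); rewrite scaler_sumr.
    rewrite (sum_grid (fun l => s *: (S (l %/ L)%N *: w (p + l)%N))).
    apply: eq_bigr => i _; rewrite !scaler_sumr; apply: eq_bigr => k _.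
    by rewrite divnMDl // divn_small ?ltn_ord // addn0 !scalerA mulrC.
  apply: (@le_trans _ _ ((n%:R^-1 * \sum_(i < n) `|S i|) ^+ 2)).
    rewrite ler_sqr ?nnegrE ?mulr_ge0 ?invr_ge0 ?sumr_ge0 //.
    rewrite normrZ gtr0_norm ?invr_gt0 // ler_pM2l ?invr_gt0 //.
    apply: le_trans (ler_norm_sum _ _ _) _; apply: ler_sum => i _.
    rewrite normrZ -[X in _ <= X]mulr1 ler_wpM2l // normrZ ger0_norm //.
    exact: sle.
  apply: le_trans (l1_l2_mean _ n0) _; rewrite rsq mulrA mulVf ?mul1r // gt_eqF //.
pose T := \sum_(l < n * L) w (p + l)%N.
have -> : \sum_(k < N) labs (a k *: x k) = ((\sum_(k < N) `|a k|) * (s / n%:R)) *: T.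
  rewrite mulr_suml scaler_suml; apply: eq_bigr => k _.
  rewrite (labs_scale H) -scalerA; congr (_ *: _).
  rewrite /x (labs_scale H) ger0_norm ?divr_ge0 //; congr (_ *: _).
  rewrite (labs_sum_disj H _ (fun l => r k (l %/ L)%N) pd); apply: eq_bigr => l _.
  by rewrite (is_sign_norm (rs _ _)) scale1r.
rewrite normrZ ger0_norm; last by rewrite mulr_ge0 ?divr_ge0 // sumr_ge0.
rewrite mulrC -mulrA ler_wpM2l ?sumr_ge0 // mulrAC ler_pdivlMr //.
by rewrite mulrC.
Qed.

(** The lower 2-estimate of [v] and the upper 2-estimate of the Rademacher block make [v k] to [x k]
    bounded. The moduli add up like the l1-norm of the coefficients, which is unbounded on the unit
    ball. *)
Lemma block_gain_l1 (v : nat -> X) (C : R) : lqfail 1 v ->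
  (forall N c, `|\sum_(k < N) c k *: v k| <= 1 -> \sum_(k < N) `|c k| `^ 2 <= C) ->
  (forall N, exists x, rademacher_block N x) -> block_gain join v.
Proof.
move=> fail low2 rad Q.
pose C' : R := `|C| + 1; have C'1 : 1 <= C' by rewrite /C' lerDr.
have C'0 : 0 < C' by lra.
pose Q1 : R := `|Q| + 1.
have [N [c [c1 hc]]] := fail (2 * C' * Q1).
have [x [xup xlow]] := rad N.
exists N, (fun k => C'^-1 *: x k), c; split.
  apply: (dominated_unit (x := fun k => C'^-1 *: x k)) => d d1.
  have -> : \sum_(k < N) d k *: (C'^-1 *: x k) = C'^-1 *: \sum_(k < N) d k *: x k.
    by rewrite scaler_sumr; apply: eq_bigr => k _; rewrite !scalerA mulrC.
  rewrite normrZ gtr0_norm ?invr_gt0 // mulrC ler_pdivrMr // mul1r.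
  rewrite -ler_sqr ?nnegrE ?(ltW C'0) //; apply: le_trans (xup d) _.
  have := low2 N d d1; rewrite (eq_bigr (fun k : 'I_N => d k ^+ 2)); last first.
    by move=> k _; rewrite -[2]/(2%:R) powR_mulrn // real_normK // num_real.
  move=> /le_trans; apply; apply: (@le_trans _ _ C').
    by rewrite /C'; have := ler_norm C; lra.
  by rewrite expr2 ler_peMr // ltW.
have -> : \sum_(k < N) labs (c k *: (C'^-1 *: x k)) = C'^-1 *: \sum_(k < N) labs (c k *: x k).
  rewrite scaler_sumr; apply: eq_bigr => k _.
  by rewrite scalerA mulrC -scalerA (labs_scale H C'^-1) gtr0_norm ?invr_gt0.
rewrite normrZ gtr0_norm ?invr_gt0 // [X in _ < X]mulrC ltr_pdivlMr //.
apply: lt_le_trans (xlow c).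
have hc' : 2 * C' * Q1 < \sum_(k < N) `|c k|.
  by apply: lt_le_trans hc _; apply: ler_sum => k _; rewrite powRr1.
have : Q * `|\sum_(k < N) c k *: v k| <= Q1.
  apply: (@le_trans _ _ (`|Q| * 1)).
    apply: (@le_trans _ _ (`|Q| * `|\sum_(k < N) c k *: v k|)); last exact: ler_wpM2l.
    by rewrite ler_wpM2r // ler_norm.
  by rewrite mulr1 /Q1 lerDl.
move=> /(ler_wpM2r (ltW C'0)); lra.
Qed.

End L1Blocks.

(** * Rademacher sums along a sequence with a lower l1-estimate *)

Section L1Case.
Variables (R : realType) (X : completeNormedModType R).
Variables (le : X -> X -> Prop) (join : X -> X -> X).
Hypothesis H : is_banach_lattice le join.
Local Notation labs := (labs join).
Implicit Types (a c d : nat -> R).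

Lemma l1_lower (v : nat -> X) : ~ lqfail 1 v -> exists2 C : R, 0 < C &
  forall N c, \sum_(k < N) `|c k| <= C * `|\sum_(k < N) c k *: v k|.
Proof.
move=> nf.
have [C0 hC0] : exists C0 : R, forall N c, `|\sum_(k < N) c k *: v k| <= 1 ->
    \sum_(k < N) `|c k| <= C0.
  apply: contrapT => no; apply: nf => C; apply: contrapT => no'; apply: no.
  exists C => N c c1; rewrite leNgt; apply/negP => lt; apply: no'; exists N, c; split=> //.
  by apply: lt_le_trans lt _; apply: ler_sum => k _; rewrite powRr1.
pose C : R := `|C0| + 1; have C1 : 0 < C by rewrite /C; have := normr_ge0 C0; lra.
exists C => // N c; set A := `|\sum_(k < N) c k *: v k|.
have A0 : 0 <= A by exact: normr_ge0.
rewrite -ler_pdivrMl //; apply/ler_addgt0Pr => e e0; rewrite ler_pdivrMl //.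
have Ae : 0 < A + e by lra.
have := hC0 N (fun k => (A + e)^-1 * c k).
have -> : \sum_(k < N) ((A + e)^-1 * c k) *: v k = (A + e)^-1 *: \sum_(k < N) c k *: v k.
  by rewrite scaler_sumr; apply: eq_bigr => k _; rewrite scalerA.
rewrite normrZ gtr0_norm ?invr_gt0 // -/A mulrC ler_pdivrMr // mul1r.
have -> : \sum_(k < N) `|(A + e)^-1 * c k| = (\sum_(k < N) `|c k|) / (A + e).
  by rewrite mulr_suml; apply: eq_bigr => k _; rewrite normrM gtr0_norm ?invr_gt0 // mulrC.
rewrite ler_pdivrMr // => /(_ ltac:(lra)) /le_trans; apply.
rewrite ler_pM2r // /C; have := ler_norm C0; lra.
Qed.

(** Concatenating the coefficients of consecutive blocks lets the lower l1-estimate be applied to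
    all blocks at once. *)
Lemma flatten_blocks (v : nat -> X) (n : nat -> nat) (gam : nat -> nat -> R) B :
  exists G : nat -> R,
   \sum_(l < \sum_(b < B) n b) G l *: v l =
     \sum_(b < B) \sum_(i < n b) gam b i *: v (\sum_(b' < b) n b' + i)%N /\
   \sum_(l < \sum_(b < B) n b) `|G l| = \sum_(b < B) \sum_(i < n b) `|gam b i|.
Proof.
elim: B => [|B [G [G1 G2]]].
  by exists (fun=> 0); rewrite !big_ord0.
set P := (\sum_(b < B) n b)%N in G1 G2.
pose G' l := if (l < P)%N then G l else gam B (l - P)%N.
have Gl (l : 'I_P) : G' l = G l by rewrite /G' ltn_ord.
have Gr i : G' (P + i)%N = gam B i by rewrite /G' ltnNge leq_addr addKn.
exists G'; rewrite big_ord_recr /= -/P !big_split_ord /= !big_ord_recr /= -/P.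
rewrite -G1 -G2; split; congr (_ + _); apply: eq_bigr => i _; by rewrite ?Gl ?Gr.
Qed.

Variable w : nat -> X.
Hypotheses (wd : disjseq le join w) (w1 : forall k, `|w k| = 1).
Variable C : R.
Hypotheses (C0 : 0 < C)
  (wC : forall N c, \sum_(k < N) `|c k| <= C * `|\sum_(k < N) c k *: w k|).

Lemma l1_lower_shift K N c :
  \sum_(j < N) `|c j| <= C * `|\sum_(j < N) c j *: w (K + j)%N|.
Proof.
pose c' l := if (K <= l)%N then c (l - K)%N else 0.
have c'0 l : (l < K)%N -> c' l = 0 by move=> lK; rewrite /c' leqNgt lK.
have c'E j : c' (K + j)%N = c j by rewrite /c' leq_addr addKn.
have := wC (K + N) c'; rewrite !big_split_ord /=.
rewrite big1 ?add0r => [|l _]; last by rewrite c'0 // normr0.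
rewrite [X in _ * `|X + _|]big1 ?add0r => [|l _]; last by rewrite c'0 // scale0r.
by under eq_bigr do rewrite c'E; under [X in _ <= _ * `|X| ]eq_bigr do rewrite c'E.
Qed.

Lemma l1_rademacher_blocks : exists z, unconditional_basic_seq z /\ ~ absolute_seq join z.
Proof.
have w0 k : le 0 (w k) by case: wd.
(* Index [k] belongs to the block given by the integer part of its binary logarithm, with [0] in
   block [0]. As [M b] exceeds every index of block [b], [k] itself numbers its Rademacher
   function. *)
pose M b := (2 ^ b.+1)%N; pose n b := (2 ^ M b)%N.
have n0 b : 0 < (n b)%:R :> R by rewrite ltr0n expn_gt0.
pose p b := (\sum_(b' < b) n b')%N.
have [r hr] := choice (fun b => rademacher R (M b)).
have rs b k i : is_sign (r b k i) by case: (hr b).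
pose beta k := trunc_log 2 k.
have betaM k : (k < M (beta k))%N by exact: trunc_log_ltn.
have beta_lt k m : (k < m)%N -> (beta k < m)%N.
  case: k => [|k] km; first by rewrite /beta trunc_log0.
  apply: leq_ltn_trans km; apply: leq_trans (ltnW (ltn_expl _ (ltnSn 1))) _; exact: trunc_logP.
pose zb b k := (n b)%:R^-1 *: \sum_(i < n b) r b k i *: w (p b + i)%N.
pose z k := zb (beta k) k.
pose cb (m : nat) c (b k : nat) : R := ((k < m)%N && (beta k == b))%:R * c k.
pose gam (m : nat) c (b i : nat) : R := (n b)%:R^-1 * \sum_(k < M b) cb m c b k * r b k i.
have zsum m c : \sum_(k < m) c k *: z k =
    \sum_(b < m) \sum_(i < n b) gam m c b i *: w (p b + i)%N.
  transitivity (\sum_(b < m) \sum_(k < M b) cb m c b k *: zb b k); last first.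
    apply: eq_bigr => b _.
    under [RHS]eq_bigr do rewrite /gam mulr_sumr scaler_suml.
    rewrite exchange_big /=; apply: eq_bigr => k _.
    rewrite /zb scalerA scaler_sumr; apply: eq_bigr => i _.
    by rewrite scalerA; congr (_ *: _); ring.
  transitivity (\sum_(b < m) \sum_(k < m) cb m c b k *: zb b k).
    rewrite exchange_big /=; apply: eq_bigr => k _.
    rewrite (bigD1 (Ordinal (beta_lt k m (ltn_ord k)))) //= /cb ltn_ord eqxx /= mul1r.
    rewrite big1 ?addr0 // => b bk; rewrite (_ : (_ == _) = false) ?mul0r ?scale0r //.
    by apply: contraNF bk => /eqP E; apply/eqP/val_inj.
  apply: eq_bigr => b _; pose T := maxn m (M b).
  have red L : (L <= T)%N -> (forall k, (L <= k)%N -> cb m c b k = 0) ->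
      \sum_(k < L) cb m c b k *: zb b k = \sum_(k < T) cb m c b k *: zb b k.
    by move=> LT c0; rewrite (sum_supp (zb b) LT c0).
  rewrite red ?leq_maxl // => [|k mk]; last by rewrite /cb ltnNge mk mul0r.
  rewrite red ?leq_maxr // => k Mk; rewrite /cb; case: eqP => [E|]; last by rewrite andbF mul0r.
  by have := betaM k; rewrite E ltnNge Mk.
pose nrm (m : nat) c : R := \sum_(b < m) \sum_(i < n b) `|gam m c b i|.
have zup m c : `|\sum_(k < m) c k *: z k| <= nrm m c.
  rewrite zsum; apply: le_trans (ler_norm_sum _ _ _) _; apply: ler_sum => b _.
  apply: le_trans (ler_norm_sum _ _ _) _; apply: ler_sum => i _.
  by rewrite normrZ w1 mulr1.
have zlow m c : nrm m c <= C * `|\sum_(k < m) c k *: z k|.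
  have [G [G1 G2]] := flatten_blocks w n (gam m c) m.
  by rewrite zsum /nrm -G1 -G2; exact: wC.
(* A selection is the mean of the identity and a sign change, and sign changes preserve the
   distribution of Rademacher sums, hence [nrm]. *)
have nrm_th m c (th : nat -> bool) : nrm m (fun k => (th k)%:R * c k) <= nrm m c.
  apply: ler_sum => b _; have [_ _ sym] := hr b.
  pose ep k : R := if th k then 1 else -1.
  have eps k : is_sign (ep k) by rewrite /ep; case: (th k); [left|right].
  have e1 i : gam m (fun k => (th k)%:R * c k) b i =
      2^-1 * (gam m c b i + (n b)%:R^-1 * \sum_(k < M b) ep k * cb m c b k * r b k i).
    rewrite /gam -mulrDr -big_split /= mulrCA; congr (_ * _); rewrite mulr_sumr.
    by apply: eq_bigr => k _; rewrite /cb /ep; case: (th k) => /=; field.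
  apply: (@le_trans _ _ (\sum_(i < n b) 2^-1 * (`|gam m c b i| +
     `|(n b)%:R^-1 * \sum_(k < M b) ep k * cb m c b k * r b k i|))).
    apply: ler_sum => i _; rewrite e1 normrM gtr0_norm ?invr_gt0 //.
    by rewrite ler_pM2l ?invr_gt0 //; exact: ler_normD.
  have := sym (fun x => `|(n b)%:R^-1 * x|) (cb m c b) ep eps.
  rewrite -mulr_sumr big_split /= => ->; rewrite /gam; lra.
exists z; split.
  apply: (@unconditional_criterion _ _ z C) => [k|m c th].
    rewrite -normr_gt0 normrZ gtr0_norm ?invr_gt0 // mulr_gt0 ?invr_gt0 //.
    have pd := disj_shift (p (beta k)) wd.
    have nk : (0 < n (beta k))%N by rewrite expn_gt0.
    have := disj_coef_le H pd (fun j => w1 _) (r (beta k) k) nk.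
    by rewrite (is_sign_norm (rs _ _ _)); apply: lt_le_trans.
  exact: le_trans (zup _ _) (le_trans (nrm_th _ _ _) (zlow _ _)).
move=> [_ [A [A1 abs]]].
(* In one block, [num] vectors have a sum of norm at most the square root of [num], but equal moduli
   whose sum has norm at least [num / C]. Absoluteness would force [num <= (A * C) ^+ 2]. *)
have [b0 hb0] := archi_nat ((A * C) ^+ 2).
pose b := b0.+1; pose m := M b.
pose a k : R := (beta k == b)%:R.
pose num := \sum_(k < m) a k.
have num_ge : b%:R <= num.
  rewrite /num /m /M expnS mul2n -addnn big_split_ord /=.
  apply: (@le_trans _ _ (\sum_(k < 2 ^ b) a (2 ^ b + k)%N)); last first.
    by rewrite lerDr sumr_ge0 // => k _; rewrite /a.
  rewrite (eq_bigr (fun=> 1)) => [|k _]; last first.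
    rewrite /a /beta (@trunc_log_eq 2 b) ?eqxx // leq_addr /= expnS mul2n -addnn ltn_add2l.
    exact: ltn_ord.
  by rewrite sumr_const card_ord ler_nat ltnW // ltn_expl.
have num0 : 0 < num by apply: lt_le_trans num_ge; rewrite ltr0n.
pose T := \sum_(i < n b) w (p b + i)%N.
have labsz k : labs (a k *: z k) = (a k / (n b)%:R) *: T.
  rewrite /a; case: eqP => [E|_]; last by rewrite mul0r !scale0r (ge0_labs H (blle_refl H 0)).
  rewrite scale1r div1r /z E /zb (labs_scale H) gtr0_norm ?invr_gt0 //; congr (_ *: _).
  have pd := disj_shift (p b) wd.
  rewrite (labs_sum_disj H _ (r b k) pd); apply: eq_bigr => i _.
  by rewrite (is_sign_norm (rs _ _ _)) scale1r.
have T1 : (n b)%:R <= C * `|T|.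
  have := l1_lower_shift (p b) (n b) (fun=> 1).
  rewrite (eq_bigr (fun=> 1)) => [|i _]; last by rewrite normr1.
  rewrite sumr_const card_ord (eq_bigr (fun i : 'I_(n b) => w (p b + i)%N)) // => i _.
  by rewrite scale1r.
have h1 : num <= C * `|\sum_(k < m) labs (a k *: z k)|.
  under eq_bigr do rewrite labsz.
  rewrite -scaler_suml -mulr_suml -/num normrZ gtr0_norm ?divr_gt0 //.
  rewrite mulrCA -[X in _ <= X]mulrA -[X in X <= _]mulr1 ler_pM2l //.
  by rewrite mulrC ler_pdivlMr // mul1r.
have h2 : `|\sum_(k < m) a k *: z k| ^+ 2 <= num.
  pose S i := \sum_(k < M b) a k * r b k i.
  have -> : \sum_(k < m) a k *: z k = (n b)%:R^-1 *: \sum_(i < n b) S i *: w (p b + i)%N.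
    under [in RHS]eq_bigr do rewrite scaler_suml.
    rewrite exchange_big /= scaler_sumr; apply: eq_bigr => k _.
    transitivity (a k *: zb b k).
      by rewrite /a /z; case: eqP => [->//|_]; rewrite !scale0r.
    rewrite /zb scalerA mulrC -[LHS]scalerA; congr (_ *: _); rewrite scaler_sumr.
    by apply: eq_bigr => i _; rewrite scalerA.
  have nb : (0 < n b)%N by rewrite expn_gt0.
  apply: (@le_trans _ _ (((n b)%:R^-1 * \sum_(i < n b) `|S i|) ^+ 2)).
    rewrite ler_sqr ?nnegrE ?mulr_ge0 ?invr_ge0 ?sumr_ge0 //.
    rewrite normrZ gtr0_norm ?invr_gt0 // ler_pM2l ?invr_gt0 //.
    apply: le_trans (ler_norm_sum _ _ _) _; apply: ler_sum => i _.
    by rewrite normrZ w1 mulr1.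
  apply: le_trans (l1_l2_mean _ nb) _.
  have [_ rsq _] := hr b; rewrite rsq mulrA mulVf ?mul1r ?gt_eqF //.
  apply: ler_sum => k _; rewrite /a; case: eqP => _; by rewrite ?expr1n ?expr0n.
have h3 := abs m a.
pose u := `|\sum_(k < m) a k *: z k|; rewrite -/u in h2 h3.
have u0 : 0 <= u by exact: normr_ge0.
have h4 : num <= A * C * u.
  apply: le_trans h1 _; rewrite mulrAC [A * u * C]mulrC ler_pM2l //.
have AC : 0 <= A * C by rewrite mulr_ge0 //; [lra|exact: ltW].
have h5 : num * num <= (A * C) ^+ 2 * num.
  apply: (@le_trans _ _ ((A * C * u) ^+ 2)).
    by rewrite -expr2 ler_sqr ?nnegrE ?(ltW num0) // mulr_ge0.
  by rewrite exprMn ler_wpM2l // sqr_ge0.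
move: h5; rewrite ler_pM2r // => h5.
have : b%:R <= b0%:R :> R by apply: le_trans num_ge (le_trans h5 hb0).
by rewrite ler_nat ltnn.
Qed.

End L1Case.

(** * Case distinction on lower estimates for tails of a disjoint sequence *)

Theorem theorem4p21 (R : realType) (X : completeNormedModType R)
  (le : X -> X -> Prop) (join : X -> X -> X) :
  is_banach_lattice le join ->
  (forall x : nat -> X, unconditional_basic_seq x -> absolute_seq join x) ->
  lattice_iso_to_AM_space join.
Proof.
move=> H abs.
have noz : ~ exists z, unconditional_basic_seq z /\ ~ absolute_seq join z.
  by move=> [z [uz nz]]; exact: nz (abs z uz).
have [[w [wd w1]]|[C hC]] := disjoint_or_bounded H; last exact: (joins_bounded_AM H hC).
have [[C hC]|unb] := pselect (exists C, joins_bounded le join C).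
  exact: (joins_bounded_AM H hC).
exfalso; apply: (noz).
have wsd K := disj_shift K wd.
have ws1 K k : `|shift K w k| = 1 by exact: w1.
have [[q [q1 q2 qf]]|nq] := pselect (exists q : R, [/\ 1 < q, q <= 2 &
    forall K, lqfail q (shift K w)]).
  apply: (glue_blocks H wd w1) => K.
  apply: (block_gain_lq H (wsd K) (ws1 K) q1 (qf K)) => C hC.
  by apply: unb; exists C.
have hq (q : R) : 1 < q -> q <= 2 -> exists K, ~ lqfail q (shift K w).
  move=> q1 q2; apply: contrapT => no; apply: nq; exists q; split=> // K.
  by apply: contrapT => nf; apply: no; exists K.
have [[K nf]|fail1] := pselect (exists K, ~ lqfail 1 (shift K w)).
  have [C C0 hC] := l1_lower nf.
  exact: (l1_rademacher_blocks H (wsd K) (ws1 K) C0 hC).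
(* In the remaining case every tail fails the lower l1-estimate, while some tail satisfies a lower
   2-estimate; the gluing is done along that tail. *)
have [K2 nf2] := hq 2 ltac:(lra) (lexx _).
have [C hC] : exists C : R, forall N (c : nat -> R), `|\sum_(k < N) c k *: shift K2 w k| <= 1 ->
    \sum_(k < N) `|c k| `^ 2 <= C.
  apply: contrapT => no; apply: nf2 => C; apply: contrapT => no'; apply: no.
  exists C => N c c1; rewrite leNgt; apply/negP => lt; apply: no'.
  by exists N, c.
apply: (glue_blocks H (wsd K2) (ws1 K2)) => K.
have sE : shift K (shift K2 w) = shift (K2 + K) w.
  by apply/funext => k; rewrite /shift addnA.
apply: (block_gain_l1 H (C := C)).
- by rewrite sE; apply: contrapT => nf; apply: fail1; exists (K2 + K)%N.
- move=> N c c1.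
  (* Padding with zeros carries the lower 2-estimate over to further tails. *)
  pose c' k := if (K <= k)%N then c (k - K)%N else 0.
  have c'0 l : (l < K)%N -> c' l = 0 by move=> lK; rewrite /c' leqNgt lK.
  have c'E j : c' (K + j)%N = c j by rewrite /c' leq_addr addKn.
  have e1 : \sum_(k < K + N) c' k *: shift K2 w k =
      \sum_(k < N) c k *: shift K (shift K2 w) k.
    rewrite big_split_ord /= big1 ?add0r => [|l _]; last by rewrite c'0 // scale0r.
    by apply: eq_bigr => j _; rewrite c'E.
  have e2 : \sum_(k < K + N) `|c' k| `^ 2 = \sum_(k < N) `|c k| `^ 2.
    rewrite big_split_ord /= big1 ?add0r => [|l _]; last by rewrite c'0 // normr0 powR0.
    by apply: eq_bigr => j _; rewrite c'E.
  by rewrite -e2; apply: hC; rewrite e1.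
- by move=> N; exact: (rademacher_block_exists H wd w1 N hq).
Qed.
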